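(* Let $(H,\|\cdot\|_H)$ be a Banach space and let $\{X_t(x):\ x\in[0,1]^d,\ t\in[0,1]\}$ be an $H$-valued stochastic field on a probability space $(\Omega,\mathcal F,\mathbb P)$. Let $\gamma>0$ and $\beta$ be real numbers such that $\beta>\gamma$ if $\gamma\ge1$ and $\beta>1/\gamma$ if $\gamma<1$. Let $k_0,r_0$ be positive real numbers with $r_0=e^{-\frac1{k_0}e^{1/\beta}}$, and let $$\varphi(r)=\begin{cases}\dfrac{\log(-k_0\log r)}{(-\log r)^{\beta}}, & 0<r\le r_0,\\[2mm] g(r), & r>r_0,\end{cases}$$ where $g$ is an arbitrary nondecreasing continuous function on $[r_0,+\infty)$ with $g(r_0)=\log(-k_0\log r_0)/(-\log r_0)^\beta$. Suppose that there is a constant $C>0$ such that $$\mathbb E\Big[\sup_{0\le t\le 1}\|X_t(x)-X_t(y)\|_H^\gamma\Big]\le C|x-y|^d\varphi(|x-y|),\qquad x,y\in[0,1]^d.$$ Let $\vartheta$ satisfy $1/\beta<\vartheta<1/\gamma$ if $\gamma\ge1$, and $1/(\beta\gamma)<\vartheta<1/\gamma$ if $\gamma<1$. Then there is a realization $\tilde X$ of $X$ such that $\tilde X$ is continuous in $x$ and, for every $\alpha\in(0,1/\gamma-\vartheta]$, $$\mathbb E\Big[\sup_{0\le t\le1}[\tilde X_t(\cdot)]_{\alpha,\varphi}^\gamma\Big]<+\infty,\quad\text{where}\quad [\tilde X_t(\cdot)]_{\alpha,\varphi}:=\sup\Big\{\frac{\|\tilde X_t(x)-\tilde X_t(y)\|_H}{\varphi(|x-y|)^\alpha}:\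 x,y\in[0,1]^d,\ x\ne y\Big\}.$$
   Context: Here $d\ge1$ is an integer and $|\cdot|$ is the Euclidean norm on $\mathbb R^d$; $\varphi(0)$ is read as $0$. A realization $\tilde X$ of $X$ is an $H$-valued stochastic field on the same probability space and with the same index set such that, for each $x\in[0,1]^d$, $\mathbb P\{\tilde X_t(x)=X_t(x)\text{ for all }t\in[0,1]\}=1$. ''Continuous in $x$'' means that for almost every $\omega$, for every $t\in[0,1]$, the map $x\mapsto\tilde X_t(x,\omega)$ is continuous on $[0,1]^d$. Writing the expectation of a supremum over $t$ presupposes that this supremum is a random variable. *)

(* Defs.v *)
From HB Require Import structures.
From mathcomp Require Import all_boot all_order all_algebra.
From mathcomp Require Import all_classical all_reals all_analysis.
From mathcomp Require Import measurable_realfun.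
Import Order.TTheory GRing.Theory Num.Theory.
Import numFieldNormedType.Exports.
Set Implicit Arguments.
Unset Strict Implicit.
Unset Printing Implicit Defensive.
Local Open Scope classical_set_scope.
Local Open Scope ring_scope.

(* The library norm on 'rV[R]_d is the maximum norm, hence this definition. *)
Definition enorm (R : realType) (d : nat) (x : 'rV[R]_d) : R :=
  Num.sqrt (\sum_(i < d) (x ord0 i) ^+ 2).

Definition cube (R : realType) (d : nat) : set 'rV[R]_d :=
  [set x | forall i : 'I_d, 0 <= x ord0 i <= 1].

Definition phi_log (R : realType) (k0 beta r : R) : R :=
  ln (- k0 * ln r) / (- ln r) `^ beta.

(* phi(0) = 0 by convention; negative arguments are irrelevant. *)
Definition phi (R : realType) (k0 r0 beta : R) (g : R -> R) (r : R) : R :=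
  if r <= 0 then 0 else if r <= r0 then phi_log k0 beta r else g r.

Section StochasticField.
Context (R : realType) (disp : measure_display) (Omega : measurableType disp).
Context (P : probability Omega R) (H : completeNormedModType R) (d : nat).

(* A field is a total function of (t, x, omega); only its values for
   t in [0, 1] and x in [0, 1]^d are meaningful. H carries its Borel
   sigma-algebra. *)
Definition stochastic_field (X : R -> 'rV[R]_d -> Omega -> H) : Prop :=
  forall (t : R) (x : 'rV[R]_d), `[0, 1]%classic t -> cube x ->
    measurable_fun setT (X t x : Omega -> g_sigma_algebraType (@open H)).

(* Measures are only meaningful on measurable sets, so measurability of the
   event of probability 1 is part of the definition. *)
Definition is_realization (X Xt : R -> 'rV[R]_d -> Omega -> H) : Prop :=
  stochastic_field Xt /\
  forall x : 'rV[R]_d, cube x ->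
    let A := [set w | forall t : R, `[0, 1]%classic t -> Xt t x w = X t x w] in
    measurable A /\ P A = 1%E.

Definition continuous_in_x (X : R -> 'rV[R]_d -> Omega -> H) : Prop :=
  {ae P, forall w, forall t : R, `[0, 1]%classic t ->
     {within @cube R d, continuous (fun x => X t x w)}}.

(* [f]_{alpha, phi}, possibly infinite *)
Definition holder_seminorm (alpha : R) (phi : R -> R) (f : 'rV[R]_d -> H) :
    \bar R :=
  ereal_sup [set z | exists x y : 'rV[R]_d, [/\ cube x, cube y, x <> y &
    z = (`|f x - f y| / phi (enorm (x - y)) `^ alpha)%:E]].

Definition sup_increment (X : R -> 'rV[R]_d -> Omega -> H) (gamma : R)
    (x y : 'rV[R]_d) (w : Omega) : \bar R :=
  ereal_sup [set (`|X t x w - X t y w| `^ gamma)%:E | t in `[0, 1]%classic].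

Definition sup_holder (X : R -> 'rV[R]_d -> Omega -> H) (gamma alpha : R)
    (phi : R -> R) (w : Omega) : \bar R :=
  ereal_sup [set (holder_seminorm alpha phi (fun x => X t x w) `^ gamma)%E
            | t in `[0, 1]%classic].

End StochasticField.

(* Main.v *)
Require Import Defs.
From HB Require Import structures.
From mathcomp Require Import all_boot all_order all_algebra.
From mathcomp Require Import all_classical all_reals all_analysis.
From mathcomp Require Import measurable_realfun.
From mathcomp Require Import ring lra zify.
Import Order.TTheory GRing.Theory Num.Theory.
Import numFieldNormedType.Exports.
Local Open Scope classical_set_scope.
Local Open Scope ring_scope.
Set Implicit Arguments.
Unset Strict Implicit.

(** Chaining over dyadic grids.  Let [v_n = phi (2^-n)] and let [S_n] be the sum,
    over the edges of the grid of mesh [2^-n], of the [gamma]-th powers of the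
    increments of the field, so that [E S_n <= C' v_n].  An increment over a
    distance about [2^-n] is at most [2 d] times [sum_(m >= n) S_m^(1/gamma)], hence
    the [alpha]-seminorm is at most a constant times
    [sum_m S_m^(1/gamma) v_m^-alpha].  Its [gamma]-th power is controlled by
    [sum_m v_m^(q-1) S_m], with [q = 1/gamma - alpha] by Jensen's inequality if
    [gamma >= 1] and [q = 1 - alpha gamma] by subadditivity if [gamma < 1]; the
    expectation of the latter is at most [C' sum_m v_m^q], which is finite because
    [v_m] is about [(log m) m^-beta] and [q beta > 1].  On the event where the sum
    for the largest [alpha] is finite the field converges along the dyadic
    approximations of [x], uniformly in [t], and the limit is the modification. *)

(** The factor [|x - y|^d] in the hypothesis is spent entirely on the number of edges, about
    [d 2^(n d)]. No power of [2^-n] is left over, so convergence rests on the logarithmic decay of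
    [v_n] alone, and the two ranges of [theta] are what makes [q beta > 1] for every admissible
    [alpha]. The supremum over [t] is taken inside [S_n] and all estimates are pointwise in the
    outcome, so one random variable serves all times. The other obstacle is measurability: a
    supremum over the uncountable set of times is known to be a random variable only for increments
    of [X], by hypothesis. The event of agreement with [X] at all times and the seminorm of the
    modification are therefore both rewritten through countable operations on such increments:
    uniform convergence of [X] along the dyadic approximations of [x] for the former, a supremum
    over pairs of grid points for the latter. *)

Section Dyadic.
Context {R : realType}.

Lemma dyadic_gt0 n : 0 < 2 ^- n :> R.
Proof. by rewrite invr_gt0 exprn_gt0. Qed.

Lemma dyadic_le m n : (m <= n)%N -> 2 ^- n <= 2 ^- m :> R.
Proof. by move=> mn; rewrite lef_pV2 ?posrE ?exprn_gt0// ler_weXn2l// ler1n. Qed.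

Lemma dyadic_cvg0 : (2 ^- n : R) @[n --> \oo] --> (0 : R).
Proof.
under eq_fun do rewrite -exprVn.
by apply: cvg_expr; rewrite ger0_norm ?invr_ge0// invf_lt1 ?ltr1n.
Qed.

End Dyadic.

(** * Sums of powers *)

Section PowerSums.
Context {R : realType}.
Implicit Types (p x y : R).

(** This is Young's inequality for [x] and [y^(p-1)] with exponents [p] and [p / (p - 1)]; the case
    [p = 1], which has no finite conjugate exponent, is linear. *)
Lemma powR_tangent p x y : 1 <= p -> 0 <= x -> 0 < y ->
  y `^ p + p * y `^ (p - 1) * (x - y) <= x `^ p.
Proof.
move=> p1 x0 y0; have [->|pn1] := eqVneq p 1.
  by rewrite subrr powRr0 !powRr1 ?(ltW y0)//; lra.
have {}p1 : 1 < p by rewrite lt_neqAle eq_sym pn1.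
have p0 : 0 < p by lra.
have pB0 : 0 < p - 1 by lra.
have pq : p^-1 + (p / (p - 1))^-1 = 1 by field; rewrite !gt_eqF.
have := conjugate_powR x0 (powR_ge0 y (p - 1)) p0 (divr_gt0 p0 pB0) pq.
rewrite -powRrM (_ : (p - 1) * (p / (p - 1)) = p); last by field; rewrite gt_eqF.
rewrite -(mulr_powRB1 (ltW y0) p0); set z := y `^ (p - 1); set u := x `^ p.
move=> /(ler_wpM2l (ltW p0)).
have -> : p * (u / p + y * z / (p / (p - 1))) = u + y * z * (p - 1).
  by field; rewrite !gt_eqF.
lra.
Qed.

(** The tangent inequality at the weighted mean [Y = Z / W], summed with the weights: the linear
    terms cancel. Since the weights are not normalized, a factor [W^(p-1)] appears. *)
Lemma weighted_jensen_powR (I : Type) (r : seq I) (w z : I -> R) p : 1 <= p ->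
  (forall i, 0 <= w i) -> (forall i, 0 <= z i) ->
  (\sum_(i <- r) w i * z i) `^ p <=
  (\sum_(i <- r) w i) `^ (p - 1) * \sum_(i <- r) w i * z i `^ p.
Proof.
move=> p1 w0 z0; have p0 : 0 < p by lra.
set W := \sum_(i <- r) w i; set Z := \sum_(i <- r) w i * z i.
have rhs0 : 0 <= W `^ (p - 1) * \sum_(i <- r) w i * z i `^ p.
  by rewrite mulr_ge0 ?powR_ge0// sumr_ge0// => i _; rewrite mulr_ge0 ?powR_ge0.
have W0 : 0 <= W by rewrite sumr_ge0.
have Z0 : 0 <= Z by rewrite sumr_ge0// => i _; rewrite mulr_ge0.
have [->|Zn0] := eqVneq Z 0; first by rewrite powR0 ?gt_eqF.
have {}Z0 : 0 < Z by rewrite lt_neqAle eq_sym Zn0.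
have {}W0 : 0 < W.
  rewrite lt_neqAle eq_sym W0 andbT; apply: contra_neq Zn0.
  rewrite /W /Z; elim: r {W Z rhs0 Z0 W0} => [|i r IH];
    rewrite ?big_nil ?big_cons// => /eqP.
  rewrite paddr_eq0 ?sumr_ge0// => /andP[/eqP -> /eqP /IH ->].
  by rewrite mul0r addr0.
pose Y := Z / W; have Y0 : 0 < Y by rewrite divr_gt0.
have ZE : Z = W * Y by rewrite /Y mulrC divfK// gt_eqF.
have -> : Z `^ p = W `^ (p - 1) * (W * Y `^ p).
  by rewrite ZE powRM ?ltW// -(mulr_powRB1 (ltW W0) p0); ring.
apply: ler_wpM2l; first exact: powR_ge0.
have : \sum_(i <- r) w i * (Y `^ p + p * Y `^ (p - 1) * (z i - Y)) <=
       \sum_(i <- r) w i * z i `^ p.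
  by apply: ler_sum => i _; apply: ler_wpM2l => //; exact: powR_tangent.
apply: le_trans; rewrite le_eqVlt; apply/orP; left; apply/eqP.
transitivity (W * Y `^ p + p * Y `^ (p - 1) * (Z - W * Y)).
  by rewrite ZE subrr mulr0 addr0 mulrC.
rewrite /W /Z !mulr_suml -sumrB mulr_sumr -big_split/=.
by apply: eq_bigr => i _; ring.
Qed.

(** A ratio [z / (x + y)] in []0, 1]] is at most its [p]-th power; add this for [z = x] and [z = y],
    whose ratios sum to 1. *)
Lemma powR_subadditive p x y : 0 < p <= 1 -> 0 <= x -> 0 <= y ->
  (x + y) `^ p <= x `^ p + y `^ p.
Proof.
move=> /andP[p0 p1] x0 y0.
have [->|xn0] := eqVneq x 0; first by rewrite add0r powR0 ?gt_eqF// add0r.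
have [->|yn0] := eqVneq y 0; first by rewrite addr0 powR0 ?gt_eqF// addr0.
have {}x0 : 0 < x by rewrite lt_neqAle eq_sym xn0.
have {}y0 : 0 < y by rewrite lt_neqAle eq_sym yn0.
have s0 : 0 < x + y by rewrite addr_gt0.
have h z : 0 < z -> z <= x + y -> z / (x + y) * (x + y) `^ p <= z `^ p.
  move=> z0 zs; rewrite -[in leRHS](divfK (lt0r_neq0 s0) z).
  rewrite powRM ?divr_ge0 ?(ltW z0) ?(ltW s0)//.
  rewrite ler_wpM2r ?powR_ge0// ger1_powR// divr_gt0//=.
  by rewrite ler_pdivrMr// mul1r.
have := lerD (h x x0 _) (h y y0 _); rewrite -mulrDl -mulrDl divff ?gt_eqF// mul1r.
by apply; lra.
Qed.

Lemma powR_sum_le (I : Type) (r : seq I) (z : I -> R) p : 0 < p <= 1 ->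
  (forall i, 0 <= z i) ->
  (\sum_(i <- r) z i) `^ p <= \sum_(i <- r) z i `^ p.
Proof.
move=> p01 z0; elim: r => [|i r IH].
  by rewrite !big_nil powR0 ?gt_eqF//; case/andP: p01.
rewrite !big_cons; apply: le_trans (powR_subadditive p01 _ _) _ => //.
  by rewrite sumr_ge0.
by rewrite lerD2l.
Qed.

(* The exponent [q] with [E (sum_n K_n v_n^-alpha)^gamma <= A sum_n v_n^q]
   whenever [E K_n^gamma <= v_n]. *)
Definition chaining_exponent (gamma alpha : R) : R :=
  if gamma < 1 then 1 - alpha * gamma else gamma^-1 - alpha.

Lemma chaining_powR_le (gamma alpha : R) (v : nat -> R) (W : R) :
  0 < gamma -> (forall n, 0 < v n) ->
  (forall N, \sum_(i < N) v i `^ chaining_exponent gamma alpha <= W) ->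
  exists2 A : R, 0 < A & forall (K : nat -> R) N, (forall n, 0 <= K n) ->
    (\sum_(i < N) K i * v i `^ (- alpha)) `^ gamma <=
    A * \sum_(i < N) v i `^ (chaining_exponent gamma alpha - 1) * K i `^ gamma.
Proof.
move=> g0 v0; rewrite /chaining_exponent; case: ltP => [g1 _|g1 hW].
  exists 1 => // K N K0; rewrite mul1r.
  apply: le_trans (powR_sum_le _ _ _) _ => [|i|]; first by rewrite g0 ltW.
    by rewrite mulr_ge0 ?powR_ge0.
  apply: ler_sum => i _; rewrite powRM ?powR_ge0// -powRrM mulrC.
  by rewrite (_ : 1 - alpha * gamma - 1 = - alpha * gamma)//; ring.
set q := gamma^-1 - alpha in hW *.
exists (`|W| `^ (gamma - 1) + 1); first by rewrite ltr_wpDl ?powR_ge0.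
move=> K N K0.
(* Jensen is applied with weights [v_i^q]: their total mass is bounded by [W] uniformly in [N], and
   [(K_i v_i^(-1/gamma))^gamma = K_i^gamma / v_i]. *)
rewrite (eq_bigr (fun i : 'I_N => v i `^ q * (K i * v i `^ (- gamma^-1)))); last first.
  move=> i _; rewrite mulrCA -powRD; last by rewrite (gt_eqF (v0 i)) implybT.
  by rewrite /q; congr (_ * powR _ _); ring.
apply: le_trans (weighted_jensen_powR _ _ _ _) _ => // [i|i|].
  exact: powR_ge0.
  by rewrite mulr_ge0 ?powR_ge0.
have -> : \sum_(i < N) v i `^ q * (K i * v i `^ (- gamma^-1)) `^ gamma =
          \sum_(i < N) v i `^ (q - 1) * K i `^ gamma.
  apply: eq_bigr => i _; rewrite powRM ?powR_ge0// -powRrM mulNr mulVf ?gt_eqF//.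
  by rewrite (@powRD _ _ q (- 1)) ?(gt_eqF (v0 i)) ?implybT//; ring.
apply: ler_wpM2r; first by rewrite sumr_ge0// => i _; rewrite mulr_ge0 ?powR_ge0.
rewrite -[leLHS]addr0 lerD//; apply: ge0_ler_powR; rewrite ?nnegrE//; first lra.
  by rewrite sumr_ge0// => i _; exact: powR_ge0.
exact: le_trans (hW N) (ler_norm _).
Qed.

(** Discrete form of the comparison with the integral of [x^-p]: with [e = p - 1], the inequality
    [(1 - 1/m)^-e >= 1 + e/m] makes [e m^-p] at most the telescoping difference
    [(m-1)^-e - m^-e]. *)
Lemma riemann_sum_bounded p : 1 < p ->
  exists B, forall N, \sum_(i < N) i.+1%:R `^ (- p) <= B :> R.
Proof.
move=> p1; pose e := p - 1; have e0 : 0 < e by rewrite /e; lra.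
have step n : e * n.+2%:R `^ (- p) <= n.+1%:R `^ (- e) - n.+2%:R `^ (- e) :> R.
  pose m : R := n.+2%:R; have m0 : 0 < m by rewrite ltr0n.
  have n0 : 0 < n.+1%:R :> R by rewrite ltr0n.
  have mE : m = n.+1%:R + 1 by rewrite /m -natr1.
  have x1 : 0 < n.+1%:R / m :> R by rewrite divr_gt0.
  have -> : n.+1%:R `^ (- e) = m `^ (- e) * (n.+1%:R / m) `^ (- e) :> R.
    by rewrite -powRM ?ltW// mulrC divfK// gt_eqF.
  have -> : n.+2%:R `^ (- p) = m `^ (- e) / m :> R.
    rewrite -/m -powR_inv1 ?ltW// -powRD ?(gt_eqF m0) ?implybT//.
    by congr powR; rewrite /e; ring.
  have : 1 + e / m <= (n.+1%:R / m) `^ (- e).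
    rewrite /powR gt_eqF//; apply: le_trans _ (expR_ge1Dx _).
    rewrite lerD2l mulNr -mulrN ler_wpM2l ?(ltW e0)// lerNr.
    have -> : n.+1%:R / m = 1 + (- m^-1).
      by rewrite (_ : n.+1%:R = m - 1) ?mulrBl ?divff ?gt_eqF ?mul1r// mE addrK.
    by apply: le_ln1Dx; rewrite ltrN2 invf_lt1// mE; lra.
  move=> /(ler_wpM2l (powR_ge0 m (- e))); rewrite -/m.
  set a := m `^ (- e); set b := _ `^ _; set c := m^-1.
  lra.
exists (1 + e^-1) => -[|N]; first by rewrite big_ord0 addr_ge0 ?invr_ge0 ?ltW.
rewrite big_ord_recl/= powR1 lerD2l.
rewrite -(ler_pM2l e0) divff ?gt_eqF// mulr_sumr.
have : \sum_(i < N) e * i.+2%:R `^ (- p) <= 1 - N.+1%:R `^ (- e) :> R.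
  elim: N => [|N IH]; first by rewrite big_ord0 powR1 subrr.
  by rewrite big_ord_recr/=; have := step N; lra.
by move=> /le_trans; apply; rewrite gerBl powR_ge0.
Qed.

Lemma bounded_sum_dominated (u v : nat -> R) (n0 : nat) (c B : R) : 0 <= c ->
  (forall n, 0 <= v n) -> (forall n, 0 <= u n) ->
  (forall n, (n0 <= n)%N -> u n <= c * v n) ->
  (forall N, \sum_(i < N) v i <= B) ->
  forall N, \sum_(i < N) u i <= \sum_(i < n0) u i + c * B.
Proof.
move=> c0 v0 u0 uv hB N.
apply: (@le_trans _ _ (\sum_(i < n0) u i + c * \sum_(i < N) v i)); last first.
  by rewrite lerD2l ler_wpM2l.
elim: N => [|N IH]; first by rewrite !big_ord0 mulr0 addr0 sumr_ge0.
have [Nn|nN] := ltnP N n0.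
  apply: (@le_trans _ _ (\sum_(i < n0) u i)).
    rewrite -[n0](subnKC Nn) big_split_ord/= lerDl sumr_ge0//.
  by rewrite lerDl mulr_ge0// sumr_ge0.
by rewrite !big_ord_recr/= mulrDr addrA lerD// uv.
Qed.

End PowerSums.

(** * The logarithmic modulus *)

Section Modulus.
Context {R : realType} (k0 r0 beta : R) (g : R -> R).
Context (k0_gt0 : 0 < k0) (r0_gt0 : 0 < r0) (beta_gt1 : 1 < beta).
Context (r0E : r0 = expR (- (k0^-1 * expR beta^-1))).
Context (g_nondecreasing : {in `[r0, +oo[ &, {homo g : r s / r <= s}}).
Context (g_continuous : {within `[r0, +oo[, continuous g}).
Context (g_r0 : g r0 = phi_log k0 beta r0).

Let beta_gt0 : 0 < beta. Proof. exact: lt_trans ltr01 beta_gt1. Qed.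

Local Notation phi_ := (phi k0 r0 beta g).

(** The modulus in the variable [s = - ln r], in which the scale [2^-n] becomes [n ln 2]. *)
Let logphi (s : R) := ln (k0 * s) / s `^ beta.

Let phi_logE r : phi_log k0 beta r = logphi (- ln r).
Proof. by rewrite /phi_log /logphi mulNr mulrN. Qed.

Let r0_lt1 : r0 < 1.
Proof. by rewrite r0E expR_lt1 oppr_lt0 mulr_gt0 ?invr_gt0 ?expR_gt0. Qed.

(** The value of [r0] is chosen for this: [r <= r0] means [ln (k0 s) >= 1 / beta], the range in
    which [logphi] decreases in [s]. *)
Let small_log (r : R) : 0 < r -> r <= r0 -> expR beta^-1 <= k0 * - ln r.
Proof.
move=> r_gt0 rr0; have : ln r <= ln r0 by rewrite ler_ln ?posrE.
rewrite {1}r0E expRK -(ler_pM2l k0_gt0) mulrN mulrA divff ?gt_eqF// mul1r mulrN.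
by rewrite lerNr.
Qed.

Let log_pos s : expR beta^-1 <= k0 * s -> 0 < s.
Proof. by move=> h; rewrite -(pmulr_rgt0 _ k0_gt0) (lt_le_trans _ h) ?expR_gt0. Qed.

Let loglog_ge s : expR beta^-1 <= k0 * s -> beta^-1 <= ln (k0 * s).
Proof.
move=> h; rewrite -[leLHS]expRK ler_ln ?posrE ?expR_gt0//.
by rewrite mulr_gt0 ?(log_pos h).
Qed.

Let loglog_gt0 s : expR beta^-1 <= k0 * s -> 0 < ln (k0 * s).
Proof. by move=> /loglog_ge; apply: lt_le_trans; rewrite invr_gt0. Qed.

Let logphi_gt0 s : expR beta^-1 <= k0 * s -> 0 < logphi s.
Proof. by move=> h; rewrite divr_gt0 ?loglog_gt0// powR_gt0 ?(log_pos h). Qed.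

(* With [u = ln (k0 s)] one has [logphi s = k0^beta u exp (-beta u)], and
   [u exp (-beta u)] decreases for [u >= 1 / beta]. *)
Let logphi_decreasing s t : expR beta^-1 <= k0 * s -> s <= t -> logphi t <= logphi s.
Proof.
move=> h st; have s_gt0 := log_pos h; have t_gt0 := lt_le_trans s_gt0 st.
have u1 := loglog_ge h.
rewrite /logphi ler_pdivrMr ?powR_gt0// mulrAC ler_pdivlMr ?powR_gt0//.
set u := ln (k0 * s) in u1 *; set v := ln (k0 * t).
have -> : t `^ beta = s `^ beta * expR (beta * (v - u)).
  rewrite /powR !gt_eqF// -expRD; congr expR.
  by rewrite /u /v !lnM ?posrE//; ring.
rewrite mulrC mulrCA ler_wpM2l ?powR_ge0//.
have uv : u <= v by rewrite ler_ln ?posrE ?mulr_gt0// ler_pM2l.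
have u_gt0 : 0 < u by apply: loglog_gt0.
apply: (@le_trans _ _ (u * (1 + beta * (v - u)))); last first.
  by rewrite ler_pM2l// expR_ge1Dx.
have : 1 <= beta * u by rewrite -ler_pdivrMl// mulr1.
move=> /(ler_wpM2r (_ : 0 <= v - u)); rewrite subr_ge0 => /(_ uv).
by rewrite mul1r; set a := v - u; rewrite (_ : v = u + a) /a; [lra | ring].
Qed.

Let phi_small (r : R) : 0 < r -> r <= r0 -> phi_ r = logphi (- ln r).
Proof. by move=> r_gt0 rr0; rewrite /phi leNgt r_gt0 rr0 phi_logE. Qed.

Let phi_large r : r0 <= r -> phi_ r = g r.
Proof.
move=> r0r; rewrite /phi leNgt (lt_le_trans r0_gt0 r0r)/=.
by case: ifPn => // rr0; have -> : r = r0 by apply/le_anti/andP.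
Qed.

Lemma phi_le (r s : R) : 0 < r -> r <= s -> phi_ r <= phi_ s.
Proof.
move=> r_gt0 rs.
have small a b : 0 < a -> a <= b -> b <= r0 -> phi_ a <= phi_ b.
  move=> a0 ab b0; have b_gt0 := lt_le_trans a0 ab.
  rewrite !phi_small//; last exact: le_trans b0.
  by rewrite logphi_decreasing ?small_log// lerN2 ler_ln ?posrE.
have large a b : r0 <= a -> a <= b -> phi_ a <= phi_ b.
  move=> a0 ab; rewrite !phi_large ?(le_trans a0)//; apply: g_nondecreasing => //.
    by rewrite in_itv/= a0.
  by rewrite in_itv/= (le_trans a0).
have [sr0|r0s] := leP s r0; first exact: small.
have [rr0|r0r] := leP r r0; last by apply: large => //; exact: ltW.
by apply: (@le_trans _ _ (phi_ r0)); [exact: small | apply: large => //; exact: ltW].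
Qed.

(** Monotonicity reduces to [min r r0], where the logarithmic formula is positive; thus [g] inherits
    positivity from its value at [r0]. *)
Lemma phi_gt0 (r : R) : 0 < r -> 0 < phi_ r.
Proof.
move=> r_gt0; have m_gt0 : 0 < Num.min r r0 by rewrite lt_min r_gt0 r0_gt0.
apply: lt_le_trans (phi_le m_gt0 _); last by rewrite ge_min lexx.
by rewrite phi_small ?ge_min ?lexx ?orbT// logphi_gt0// small_log// ge_min lexx orbT.
Qed.

Let logphi_continuous (r : R) : 0 < r < 1 -> {for r, continuous (logphi \o -%R \o @ln R)}.
Proof.
move=> /andP[r_gt0 r1]; apply: continuous_comp; first exact: continuous_ln.
apply: continuous_comp; first exact: opp_continuous.
have s_gt0 : 0 < - ln r by rewrite oppr_gt0 ln_lt0// r_gt0.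
apply: cvgM.
  apply: (@continuous_comp _ _ _ ( *%R k0)).
    exact: mulrl_continuous.
  by apply: continuous_ln; rewrite mulr_gt0.
apply: cvgV; first by rewrite gt_eqF// powR_gt0.
apply: (@differentiable_continuous _ _ _ _ (fun s : R => s `^ beta)).
by apply/derivable1_diffP; apply: derivable_powR; rewrite in_itv/= s_gt0.
Qed.

(** For [s < r] monotonicity suffices, so only continuity from the right matters. At [r0] this
    concerns [g] alone, and the two branches need not be glued. *)
Lemma phi_right_usc (r e : R) : 0 < r -> 0 < e ->
  exists2 delta, 0 < delta & forall s, s < r + delta -> phi_ s < phi_ r + e.
Proof.
move=> r_gt0 e_gt0.
suff [delta d_gt0 h] : exists2 delta, 0 < delta &
    forall s, r <= s -> s < r + delta -> phi_ s < phi_ r + e.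
  exists delta => // s srd; have [|sr] := leP r s; first by move/h; exact.
  have [s0|s_le0] := ltP 0 s.
    by apply: le_lt_trans (phi_le s0 (ltW sr)) _; rewrite ltrDl.
  by rewrite {1}/phi s_le0 addr_gt0// phi_gt0.
have [rr0|r0r] := ltP r r0.
  have /cvgrPdist_lt /(_ e e_gt0) : {for r, continuous (logphi \o -%R \o @ln R)}.
    by apply: logphi_continuous; rewrite r_gt0 (lt_trans rr0).
  move=> /nbhs_ballP[d /= d_gt0 hd].
  exists (Num.min d (r0 - r)); first by rewrite lt_min d_gt0 subr_gt0.
  move=> s rs; rewrite -ltrBlDl lt_min => /andP[sd sr0].
  have := hd s; rewrite /ball/= => /(_ _)/wrap[].
    by rewrite ler0_norm ?subr_le0// opprB.
  rewrite !phi_small ?(ltW rr0) ?(lt_le_trans r_gt0)//; last lra.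
  by rewrite ltr_distlC => /andP[_].
have /subspace_continuousP /(_ r) := g_continuous.
rewrite /= in_itv/= r0r => /(_ isT) /cvgrPdist_lt /(_ e e_gt0).
move=> /nbhs_ballP[d /= d_gt0 hd]; exists d => // s rs sd.
rewrite !phi_large ?(le_trans r0r)//.
have := hd s; rewrite /ball/= => /(_ _)/wrap[].
  by rewrite ler0_norm ?subr_le0// opprB ltrBlDl.
rewrite in_itv/= (le_trans r0r)// => /(_ isT).
by rewrite ltr_distlC => /andP[_].
Qed.

Let L : R := ln 2.
Let L_gt0 : 0 < L. Proof. by rewrite ln_gt0// ltr1n. Qed.

Let ln_dyadic n : - ln (2 ^- n : R) = n%:R * L.
Proof. by rewrite lnV ?posrE ?exprn_gt0// opprK lnXn// [RHS]mulr_natl. Qed.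

Let dyadic_small : exists n0, forall n, (n0 <= n)%N -> (0 < n)%N /\ 2 ^- n <= r0.
Proof.
exists (Num.truncn (- ln r0 / L)).+1 => n n0n; split; first by case: n n0n.
rewrite -ler_ln ?posrE ?dyadic_gt0// -lerN2 ln_dyadic -ler_pdivrMr//.
by apply: le_trans (ltW (truncnS_gt _)) _; rewrite ler_nat.
Qed.

(** Chaining produces the modulus at [2^-n], while the distance of the two points is only known to
    be at least [2^-(n+1)]; this bridges the gap. For large [n] it holds because [n + 1 <= 2 n] and
    the double logarithm increases. *)
Lemma phi_dyadic_doubling :
  exists2 c, 0 < c & forall n, phi_ (2 ^- n) <= c * phi_ (2 ^- n.+1).
Proof.
have [n0 hn0] := dyadic_small.
have pos n : 0 < phi_ (2 ^- n) by apply: phi_gt0; exact: dyadic_gt0.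
(* The first term serves the scales in the logarithmic range, the second the finitely many [n < n0],
   by monotonicity. *)
exists (2 `^ beta + phi_ (2 ^- 0) / phi_ (2 ^- n0)).
  by rewrite addr_gt0 ?powR_gt0 ?divr_gt0.
move=> n; have [n_lt|n0n] := ltnP n n0.
  apply: (@le_trans _ _ (phi_ (2 ^- 0) / phi_ (2 ^- n0) * phi_ (2 ^- n.+1))); last first.
    by rewrite ler_pM2r// lerDr powR_ge0.
  apply: (@le_trans _ _ (phi_ (2 ^- 0))).
    by apply: phi_le; [exact: dyadic_gt0 | exact: dyadic_le].
  rewrite -[leLHS](divfK (lt0r_neq0 (pos n0))) ler_pM2l ?divr_gt0//.
  by apply: phi_le; [exact: dyadic_gt0 | exact: dyadic_le].
have [n_gt0 nr0] := hn0 n n0n; have [_ nr0'] := hn0 n.+1 (leqW n0n).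
apply: (@le_trans _ _ (2 `^ beta * phi_ (2 ^- n.+1))); last first.
  by rewrite ler_pM2r// lerDl divr_ge0 ?ltW.
have h := small_log (dyadic_gt0 n) nr0.
have s_gt0 := log_pos h.
rewrite !phi_small ?dyadic_gt0// !ln_dyadic in h s_gt0 *.
have nL : n%:R * L <= n.+1%:R * L by rewrite ler_pM2r// ler_nat.
rewrite /logphi ler_pdivrMr ?powR_gt0//.
rewrite [leRHS]mulrAC [_ * (_ / _)]mulrA ler_pdivlMr ?powR_gt0 ?(lt_le_trans s_gt0)//.
rewrite -powRM ?(ltW s_gt0)// mulrC.
apply: ler_pM; rewrite ?powR_ge0 ?(ltW (loglog_gt0 h))//.
  apply: ge0_ler_powR; rewrite ?nnegrE ?mulr_ge0 ?(ltW L_gt0) ?(ltW beta_gt0)//.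
  rewrite mulrA (ler_pM2r L_gt0) -natrM ler_nat; lia.
have s1_gt0 : 0 < n.+1%:R * L by exact: lt_le_trans s_gt0 nL.
by rewrite ler_ln ?posrE ?ler_pM2l// mulr_gt0.
Qed.

Lemma phi_dyadic_summable q : 0 < q -> 1 < q * beta ->
  exists W, forall N, \sum_(i < N) phi_ (2 ^- i) `^ q <= W.
Proof.
move=> q_gt0 qb.
(* [ln y <= y^d / d] gives [phi (2^-n) <= c n^(d - beta)] for large [n], and
   this choice of [d] makes [q (beta - d)] exceed 1. *)
pose d := (beta - q^-1) / 2; pose p := (q * beta + 1) / 2.
have d_gt0 : 0 < d.
  by rewrite divr_gt0// subr_gt0 -(ltr_pM2l q_gt0) divff ?gt_eqF.
have pE : q * (beta - d) = p by rewrite /p /d; field; rewrite gt_eqF.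
have p1 : 1 < p by rewrite /p; lra.
have [B hB] := riemann_sum_bounded p1.
have [n0 hn0] := dyadic_small.
pose c := ((k0 * L) `^ d / d / L `^ beta) `^ q.
exists (\sum_(i < n0.+1) phi_ (2 ^- i) `^ q + c * (1 + B)) => N.
apply: (@bounded_sum_dominated R (fun n => phi_ (2 ^- n) `^ q)
  (fun n => n%:R `^ (- p)) n0.+1 c (1 + B)) => [||n|n n0n|M].
- exact: powR_ge0.
- by move=> n; exact: powR_ge0.
- exact: powR_ge0.
- have [n_gt0 nr0] := hn0 n (ltnW n0n).
  have h := small_log (dyadic_gt0 n) nr0.
  rewrite phi_small ?dyadic_gt0// ln_dyadic in h *.
  have nR : 0 < n%:R :> R by rewrite ltr0n.
  have -> : c * n%:R `^ (- p) = ((k0 * (n%:R * L)) `^ d / d / (n%:R * L) `^ beta) `^ q.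
    have -> : (k0 * (n%:R * L)) `^ d / d / (n%:R * L) `^ beta =
              (k0 * L) `^ d / d / L `^ beta * n%:R `^ (d - beta).
      rewrite powRB ?(gt_eqF nR) ?implybT// mulrCA !(@powRM _ n%:R) ?mulr_ge0 ?ltW//.
      by field; rewrite !gt_eqF ?powR_gt0.
    rewrite [RHS]powRM; first rewrite -powRrM; last 2 first.
      by do 2?apply: divr_ge0; rewrite ?powR_ge0 ?(ltW d_gt0).
      exact: powR_ge0.
    by rewrite -pE; congr (_ * powR _ _); ring.
  apply: ge0_ler_powR; rewrite ?nnegrE ?(ltW q_gt0)//.
    exact/ltW/logphi_gt0.
    by do 2?apply: divr_ge0; rewrite ?powR_ge0 ?(ltW d_gt0).
  rewrite /logphi ler_pM2r ?invr_gt0 ?powR_gt0 ?mulr_gt0// ler_pdivlMr//.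
  rewrite mulrC -ln_powR ltW// ln_sublinear// powR_gt0//.
  exact: lt_le_trans (expR_gt0 _) h.
case: M => [|M]; first by rewrite big_ord0; have := hB 0%N; rewrite big_ord0; lra.
(* The term [n = 0] of the comparison sequence vanishes, since [0] to a nonzero exponent is [0];
   what remains is the Riemann sum. *)
rewrite big_ord_recl/= powR0 ?add0r; last by rewrite oppr_eq0; lra.
by have := hB M; rewrite /bump/=; lra.
Qed.

End Modulus.

(** * Dyadic grids and chaining *)

Section EuclideanNorm.
Context {R : realType} {d : nat}.
Implicit Types x y : 'rV[R]_d.

Lemma enorm_ge0 x : 0 <= enorm x.
Proof. exact: sqrtr_ge0. Qed.

Lemma coord_le_enorm x i : `|x ord0 i| <= enorm x.
Proof.
rewrite -sqrtr_sqr ler_wsqrtr// (bigD1 i)//= lerDl sumr_ge0// => j _.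
exact: sqr_ge0.
Qed.

Lemma enorm_gt0 x : x != 0 -> 0 < enorm x.
Proof.
move=> xn0; rewrite lt_neqAle enorm_ge0 andbT; apply: contra_neq xn0 => x0.
apply/rowP => i; rewrite mxE; apply/eqP; rewrite -normr_le0 x0.
exact: coord_le_enorm.
Qed.

Lemma enorm_le x (e : R) : 0 <= e -> (forall i, `|x ord0 i| <= e) ->
  enorm x <= d%:R * e.
Proof.
move=> e0 xe; rewrite -[leRHS]ger0_norm ?mulr_ge0// -sqrtr_sqr ler_wsqrtr//.
apply: (@le_trans _ _ (\sum_(i < d) e ^+ 2)).
  apply: ler_sum => i _; rewrite -real_normK ?num_real//.
  by rewrite lerXn2r ?nnegrE.
rewrite sumr_const card_ord -[leLHS]mulr_natl exprMn ler_wpM2r ?sqr_ge0//.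
by rewrite -natrX ler_nat; case: d => // n; rewrite leq_pmulr.
Qed.

Lemma enorm_cvg (u : nat -> 'rV[R]_d) x :
  (forall i, u n ord0 i @[n --> \oo] --> x ord0 i) ->
  enorm (u n) @[n --> \oo] --> enorm x.
Proof.
move=> ux; rewrite /enorm; apply: continuous_cvg; first exact: sqrt_continuous.
apply: cvg_big => [|i _]; first exact: add_continuous.
rewrite expr2.
under eq_fun do rewrite expr2.
by apply: cvgM; exact: ux.
Qed.

End EuclideanNorm.

(** * Dyadic grids of the cube *)

Section Grid.
Context {R : realType} {d : nat}.
Implicit Types (x y : 'rV[R]_d) (a b : 'I_d -> nat).

(* Clamping at 1 keeps the point inside the cube for every multi-index. *)
Definition grid (n : nat) a : 'rV[R]_d :=
  \row_i Num.min 1 ((a i)%:R * 2 ^- n).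

Definition grid_proj (n : nat) x : 'rV[R]_d :=
  grid n (fun i => Num.truncn (x ord0 i * 2 ^+ n)).

Definition shift_axis a (i : 'I_d) : 'I_d -> nat := fun j => (a j + (j == i))%N.

Lemma grid_cube n a : cube (grid n a).
Proof.
by move=> i; rewrite mxE le_min ler01 mulr_ge0 ?(ltW (dyadic_gt0 n))// ge_min lexx.
Qed.

Lemma grid_proj_coord n x i : cube x ->
  grid_proj n x ord0 i = (Num.truncn (x ord0 i * 2 ^+ n))%:R * 2 ^- n /\
  grid_proj n x ord0 i <= x ord0 i < grid_proj n x ord0 i + 2 ^- n.
Proof.
move=> /(_ i) /andP[x0 x1]; have p0 : 0 < 2 ^+ n :> R by rewrite exprn_gt0.
have /andP[] : (Num.truncn (x ord0 i * 2 ^+ n))%:R <= x ord0 i * 2 ^+ n <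
    (Num.truncn (x ord0 i * 2 ^+ n)).+1%:R by rewrite truncn_itv// mulr_ge0// ltW.
rewrite -[X in _ < X]natr1; set t := (Num.truncn _)%:R => l u.
have tx : t * 2 ^- n <= x ord0 i by rewrite ler_pdivrMr.
have -> : grid_proj n x ord0 i = t * 2 ^- n.
  by rewrite mxE -/t min_r//; exact: le_trans x1.
split=> //; rewrite tx.
have -> : t * 2 ^- n + 2 ^- n = (t + 1) * 2 ^- n by rewrite mulrDl mul1r.
by rewrite ltr_pdivlMr.
Qed.

Lemma grid_proj_cvg x i : cube x ->
  grid_proj n x ord0 i @[n --> \oo] --> x ord0 i.
Proof.
move=> cx; apply/cvgrPdist_le => e e0.
have /cvgrPdist_le /(_ e e0) := @dyadic_cvg0 R; apply: filterS => n.
rewrite sub0r normrN ger0_norm ?(ltW (dyadic_gt0 n))// => ne.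
have [_ /andP[l u]] := grid_proj_coord n i cx.
by rewrite ger0_norm; lra.
Qed.

Lemma grid_proj_dist n x : cube x -> enorm (x - grid_proj n x) <= d%:R * 2 ^- n.
Proof.
move=> cx; apply: enorm_le; first exact/ltW/dyadic_gt0.
move=> i; rewrite !mxE -/(grid_proj n x ord0 i).
have [_ /andP[l u]] := grid_proj_coord n i cx; move: l u; rewrite mxE => l u.
by rewrite ger0_norm; lra.
Qed.

Lemma grid_refine n a : grid n a = grid n.+1 (fun i => 2 * a i)%N.
Proof.
apply/rowP => i; rewrite !mxE; congr Num.min.
by rewrite natrM exprS invfM mulrACA divff ?mul1r// pnatr_eq0.
Qed.

(** A clamped coordinate times [2^m] is an integer, so truncation leaves it alone. Hence the dyadic
    approximations of a grid point are eventually constant. *)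
Lemma grid_projK m n a : (n <= m)%N -> grid_proj m (grid n a) = grid n a.
Proof.
move=> nm; apply/rowP => i; rewrite !mxE.
have p0 k : 0 < 2 ^+ k :> R by rewrite exprn_gt0.
have E : Num.min 1 ((a i)%:R * 2 ^- n) * 2 ^+ m =
         (minn (2 ^ n) (a i) * 2 ^ (m - n))%N%:R :> R.
  have -> : 2 ^+ m = 2 ^+ n * 2 ^+ (m - n) :> R by rewrite -exprD subnKC.
  rewrite mulrA natrM natrX; congr (_ * _).
  have [h|h] := leP 1 ((a i)%:R * 2 ^- n : R).
    rewrite mul1r (minn_idPl _) ?natrX// -(ler_nat R) natrX.
    by move: h; rewrite ler_pdivlMr// mul1r.
  rewrite divfK ?gt_eqF// (minn_idPr _)// -(ler_nat R) natrX.
  by move: h => /ltW; rewrite ler_pdivrMr// mul1r.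
rewrite E natrK -E mulfK ?gt_eqF//.
by apply/min_idPr; rewrite ge_min lexx.
Qed.

(** Reduces arbitrary multi-indices to the finite set over which the edges are summed. *)
Lemma grid_clamp n a : grid n a = grid n (fun i => minn (2 ^ n) (a i)).
Proof.
apply/rowP => i; rewrite !mxE.
have p0 : 0 < 2 ^+ n :> R by rewrite exprn_gt0.
have [h|h] := leqP (2 ^ n) (a i); last by [].
rewrite natrX divff ?gt_eqF// minxx min_l//.
by rewrite ler_pdivlMr// mul1r -natrX ler_nat.
Qed.

(** The first alternative is a point on the face where coordinate [i] equals 1: clamping makes the
    edge degenerate there. *)
Lemma shift_axis_dist n a i : grid n (shift_axis a i) = grid n a \/
  enorm (grid n a - grid n (shift_axis a i)) = 2 ^- n.
Proof.
have p0 : 0 < 2 ^+ n :> R by rewrite exprn_gt0.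
have off j : j != i -> grid n (shift_axis a i) ord0 j = grid n a ord0 j.
  by move=> ji; rewrite !mxE /shift_axis (negbTE ji) addn0.
have [h|h] := leqP (2 ^ n) (a i).
  left; apply/rowP => j; have [->|] := eqVneq j i; last exact: off.
  rewrite !mxE /shift_axis eqxx !min_l// ler_pdivlMr// mul1r -natrX ler_nat//.
  by rewrite addn1 leqW.
right; rewrite /enorm (bigD1 i)//= big1 ?addr0; last first.
  by move=> j /off; rewrite !mxE => ->; rewrite subrr expr0n.
rewrite sqrtr_sqr !mxE /shift_axis eqxx addn1 !min_r.
- by rewrite -mulrBl -natr1 opprD addrA subrr sub0r mulN1r normrN ger0_norm// ltW.
- by rewrite ler_pdivrMr// mul1r -natrX ler_nat.
- by rewrite ler_pdivrMr// mul1r -natrX ler_nat ltnW.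
Qed.

(** Take the least level [n + 1] at which some coordinate gap exceeds the mesh: at level [n] no gap
    does, and a single large gap bounds the Euclidean distance from below. *)
Lemma dyadic_scale x y : cube x -> cube y -> x <> y ->
  exists n, (forall i, `|x ord0 i - y ord0 i| <= 2 ^- n) /\ 2 ^- n.+1 <= enorm (x - y).
Proof.
move=> cx cy xy.
pose far n := [exists i, 2 ^- n < `|x ord0 i - y ord0 i|].
have ex_far : exists n, far n.
  have /eqP/rowP/boolp.existsNP[i /eqP] : x != y by apply/eqP.
  rewrite -subr_eq0 -normr_gt0 => xyi.
  have /cvgrPdist_lt /(_ _ xyi) [n _ /(_ n (leqnn n))] := @dyadic_cvg0 R.
  rewrite /= sub0r normrN ger0_norm ?(ltW (dyadic_gt0 n))// => h.
  by exists n; apply/existsP; exists i.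
(* Level 0 is excluded because coordinates in [[0, 1]] differ by at most 1. *)
case: (ex_minnP ex_far) => -[|n] /existsP[i hi] nmin.
  have := cx i; have := cy i => /andP[y0 y1] /andP[x0 x1].
  by move: hi; rewrite expr0 invr1 ltNge ler_norml; lra.
exists n; split; last first.
  apply: le_trans (ltW hi) _.
  by have := coord_le_enorm (x - y) i; rewrite !mxE.
move=> j; rewrite leNgt; apply/negP => hj.
by have := nmin n; rewrite ltnn => /(_ _)/wrap[] //; apply/existsP; exists j.
Qed.

End Grid.

(** * Chaining up to a finite level *)

Section Chaining.
Context {R : realType} {d : nat} {V : normedModType R}.
Context (f : 'rV[R]_d -> V) (K : nat -> R).
Context (K_ge0 : forall n, 0 <= K n).
Context (hK : forall n a i,
  `|f (grid n a) - f (grid n (shift_axis a i))| <= K n).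
Implicit Types (x y : 'rV[R]_d) (a b : 'I_d -> nat).

Lemma grid_neighbours n a b :
  (forall i, (a i <= (b i).+1)%N && (b i <= (a i).+1)%N) ->
  `|f (grid n a) - f (grid n b)| <= d%:R * K n.
Proof.
move=> ab.
(* Replace the coordinates of [a] by those of [b] one at a time. *)
pose c k : 'I_d -> nat := fun i => if (i < k)%N then b i else a i.
have c0 : c 0 = a by apply/funext.
have cd : c d = b by apply/funext => i; rewrite /c ltn_ord.
suff : forall k, (k <= d)%N -> `|f (grid n (c 0)) - f (grid n (c k))| <= k%:R * K n.
  by move=> /(_ d (leqnn d)); rewrite c0 cd.
elim=> [|k IH] kd; first by rewrite subrr normr0 mul0r.
rewrite -natr1 mulrDl mul1r -(subrKA (f (grid n (c k)))).
apply: le_trans (ler_normD _ _) (lerD (IH (ltnW kd)) _).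
pose i := Ordinal kd.
have ck j : j != i -> c k.+1 j = c k j.
  move=> ji; rewrite /c ltnS leq_eqVlt (_ : (j == k :> nat) = false)//.
  by apply/negP => /eqP jk; move/eqP: ji; apply; exact/val_inj.
have cki : c k i = a i by rewrite /c/= ltnn.
have cki' : c k.+1 i = b i by rewrite /c/= ltnSn.
have /andP[h1 h2] := ab i.
have [e|ne] := eqVneq (a i) (b i).
  rewrite (_ : c k.+1 = c k) ?subrr ?normr0//.
  by apply/funext => j; have [->|/ck//] := eqVneq j i; rewrite cki cki'.
have [lt|gt] := ltnP (a i) (b i).
  rewrite (_ : c k.+1 = shift_axis (c k) i)//.
  apply/funext => j; rewrite /shift_axis; have [->|/ck->] := eqVneq j i.
    by rewrite cki cki'; lia.
  by rewrite addn0.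
rewrite distrC (_ : c k = shift_axis (c k.+1) i)//.
apply/funext => j; rewrite /shift_axis; have [->|/ck->] := eqVneq j i.
  by rewrite cki cki'; move/eqP: ne; lia.
by rewrite addn0.
Qed.

(** After scaling by [2^n] the coordinates differ by at most 1, hence so do their integer parts. *)
Lemma grid_proj_neighbours n x y : cube x -> cube y ->
  (forall i, `|x ord0 i - y ord0 i| <= 2 ^- n) ->
  `|f (grid_proj n x) - f (grid_proj n y)| <= d%:R * K n.
Proof.
move=> cx cy xy; apply: grid_neighbours.
have p0 : 0 < 2 ^+ n :> R by rewrite exprn_gt0.
have h (u v : R) : 0 <= u -> 0 <= v -> `|u - v| <= 2 ^- n ->
    (Num.truncn (u * 2 ^+ n) <= (Num.truncn (v * 2 ^+ n)).+1)%N.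
  move=> u0 v0; rewrite ler_norml => /andP[_].
  rewrite -[2 ^- n]mul1r ler_pdivlMr// mulrBl => uv.
  have /andP[l _] := truncn_itv (mulr_ge0 u0 (ltW p0)).
  have /andP[_ r] := truncn_itv (mulr_ge0 v0 (ltW p0)).
  by rewrite -ltnS -(ltr_nat R) -[X in _ < X]natr1; lra.
move=> i; have /andP[x0 _] := cx i; have /andP[y0 _] := cy i.
by rewrite !h// distrC.
Qed.

(** Seen in the grid of level [n + 1], the two points have indices [2 s] and [t], where [s] and [t]
    are the integer parts of [u] and [2 u]; these differ by at most 1. *)
Lemma grid_proj_succ n x : cube x ->
  `|f (grid_proj n.+1 x) - f (grid_proj n x)| <= d%:R * K n.+1.
Proof.
move=> cx; rewrite {2}/grid_proj grid_refine; apply: grid_neighbours => i.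
have /andP[x0 _] := cx i; rewrite exprS mulrCA; set u := x ord0 i * _.
have u0 : 0 <= u by rewrite mulr_ge0// exprn_ge0.
have /andP[l1 r1] := truncn_itv u0.
have /andP[l2 r2] := truncn_itv (mulr_ge0 (ler0n R 2) u0).
move: l1 r1 l2 r2; rewrite -![X in _ < X]natr1.
set s := Num.truncn u; set t := Num.truncn _ => l1 r1 l2 r2.
apply/andP; split; rewrite -ltnS -(ltr_nat R) -!natr1 natrM; lra.
Qed.

Local Notation S := (fun n => \sum_(i < n) K i).

Let S_nd : nondecreasing_seq S.
Proof. by apply/nondecreasing_seqP => n; rewrite big_ord_recr/= lerDl. Qed.

Lemma chaining_levels n N x : (n <= N)%N -> cube x ->
  `|f (grid_proj N x) - f (grid_proj n x)| <= d%:R * (S N.+1 - S n.+1).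
Proof.
move=> nN cx; rewrite -(subnK nN); elim: (N - n)%N => [|k IH].
  by rewrite add0n !subrr normr0 mulr0.
rewrite addSn -(subrKA (f (grid_proj (k + n) x))) big_ord_recr/=.
apply: le_trans (ler_normD _ _) _; have := grid_proj_succ (k + n) cx.
move: IH; rewrite /=; set A := `|_ - _|; set B := `|_ - _|; lra.
Qed.

(** Three legs: from level [N] down to level [n] under [x], across at level [n], and up again under
    [y]. Levels above [n] are used twice; the crossing costs [d K_n], which is why the sum starts at
    [n]. *)
Lemma chaining_pair n N x y : (n <= N)%N -> cube x -> cube y ->
  (forall i, `|x ord0 i - y ord0 i| <= 2 ^- n) ->
  `|f (grid_proj N x) - f (grid_proj N y)| <= 2 * d%:R * (S N.+1 - S n).
Proof.
move=> nN cx cy xy.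
have h1 := chaining_levels nN cx; have h2 := chaining_levels nN cy.
have h3 := grid_proj_neighbours cx cy xy.
rewrite -(subrKA (f (grid_proj n x))) -[X in _ + X](subrKA (f (grid_proj n y))).
apply: le_trans (ler_normD _ _) _; apply: le_trans (lerD (lexx _) (ler_normD _ _)) _.
rewrite [`|f (grid_proj n y) - _|]distrC.
have : S n.+1 = S n + K n by rewrite big_ord_recr.
have : 0 <= d%:R * K n by rewrite mulr_ge0.
move: h1 h2 h3; rewrite /= => h1 h2 h3 h4 h5; rewrite h5 in h1 h2.
move: h1 h2 h3 h4; rewrite !mulrBr !mulrDr; set A := `|_ - _|; set B := `|_ - _|.
set C := `|_ - _|.
lra.
Qed.

(** Since [v] is nonincreasing, [v_n^-alpha <= v_m^-alpha] for [m >= n], so the weight can be moved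
    inside the sum over the levels. *)
Lemma chaining_holder (v : nat -> R) (alpha M : R) n N x y :
  0 < alpha -> (forall m, 0 < v m) -> (forall m, v m.+1 <= v m) ->
  (forall m, \sum_(i < m) K i * v i `^ (- alpha) <= M) ->
  cube x -> cube y -> (n <= N)%N ->
  (forall i, `|x ord0 i - y ord0 i| <= 2 ^- n) ->
  `|f (grid_proj N x) - f (grid_proj N y)| * v n `^ (- alpha) <= 2 * d%:R * M.
Proof.
move=> al0 v0 vle hM cx cy nN xy.
apply: le_trans (ler_wpM2r (powR_ge0 _ _) (chaining_pair nN cx cy xy)) _.
rewrite -[leLHS]mulrA; apply: ler_wpM2l; first by rewrite mulr_ge0.
apply: le_trans (hM N.+1).
have vn m : (n <= m)%N -> v n `^ (- alpha) <= v m `^ (- alpha).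
  move=> nm; rewrite !powRN lef_pV2 ?posrE ?powR_gt0//.
  apply: ge0_ler_powR; rewrite ?nnegrE ?(ltW (v0 _)) ?(ltW al0)//.
  rewrite -(subnK nm); elim: (m - n)%N => [|k]; first by rewrite add0n.
  by apply: le_trans; exact: vle.
elim: N nN => [|N IH]; rewrite leq_eqVlt => /predU1P[nN|nN].
- by rewrite nN big_ord_recr/= big_ord0 big_ord_recr/= big_ord0 !add0r subr0.
- by [].
- rewrite nN [S _.+1]big_ord_recr/= addrAC subrr add0r.
  by rewrite [leRHS]big_ord_recr/= lerDr sumr_ge0// => i _; rewrite mulr_ge0 ?powR_ge0.
- rewrite [S _.+1]big_ord_recr/= addrAC mulrDl [leRHS]big_ord_recr/=.
  by apply: lerD; [exact: IH|apply: ler_wpM2l => //; apply: vn; exact: ltnW].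
Qed.

End Chaining.

(** * Limits along the dyadic approximations *)

Section GridLimit.
Context {R : realType} {d : nat} {V : completeNormedModType R}.

Definition grid_lim (f : 'rV[R]_d -> V) (x : 'rV[R]_d) : V :=
  lim (f (grid_proj n x) @[n --> \oo]).

Lemma grid_lim_grid (f : 'rV[R]_d -> V) n a : grid_lim f (grid n a) = f (grid n a).
Proof.
apply/cvg_lim => //; apply: cvg_near_cst; exists n => // m /= nm.
by rewrite grid_projK.
Qed.

Context (f : 'rV[R]_d -> V) (K : nat -> R).
Context (K_ge0 : forall n, 0 <= K n).
Context (hK : forall n a i,
  `|f (grid n a) - f (grid n (shift_axis a i))| <= K n).
Local Notation S := (fun n => \sum_(i < n) K i).
Context (S_cvg : cvgn S).
Implicit Types (x y : 'rV[R]_d).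

Let S_nd : nondecreasing_seq S.
Proof. by apply/nondecreasing_seqP => n; rewrite big_ord_recr/= lerDl. Qed.

Let S_le n : S n <= limn S.
Proof. exact: (nondecreasing_cvgn_le S_nd S_cvg). Qed.

Let tail_small e : 0 < e -> \forall n \near \oo, 2 * d%:R * (limn S - S n) < e.
Proof.
move=> e0; have /cvgrPdist_lt : S n @[n --> \oo] --> limn S by [].
have D0 : 0 < 2 * d%:R + 1 :> R by rewrite ltr_wpDl// mulr_ge0.
move=> /(_ (e / (2 * d%:R + 1)) (divr_gt0 e0 D0)); apply: filterS => n.
rewrite ger0_norm ?subr_ge0// ltr_pdivlMr// mulrC; apply: le_lt_trans.
by rewrite ler_wpM2r ?subr_ge0// lerDl.
Qed.

Lemma grid_lim_cvg x : cube x ->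
  f (grid_proj n x) @[n --> \oo] --> grid_lim f x.
Proof.
move=> cx; apply/cauchy_cvgP/cauchy_exP => e /= e0.
have [n _ hn] := tail_small e0; exists (f (grid_proj n x)); exists n => // N /= nN.
rewrite -ball_normE/= distrC.
apply: le_lt_trans (chaining_levels K_ge0 hK nN cx) _.
apply: le_lt_trans (hn n (leqnn n)).
have := S_le N.+1; have : S n <= S n.+1 by rewrite S_nd.
rewrite /= => h1 h2; rewrite -[leRHS]mulrA mulrCA ler_wpM2l//.
have := S_le n.+1; rewrite /= => h3; lra.
Qed.

(** The bound involves [f] only through [K]. Applied to all [X t] with one common [K], it gives
    convergence uniform in [t]. *)
Lemma grid_lim_tail x n : cube x ->
  `|grid_lim f x - f (grid_proj n x)| <= d%:R * (limn S - S n.+1).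
Proof.
move=> cx.
have : `|f (grid_proj N x) - f (grid_proj n x)| @[N --> \oo] -->
       `|grid_lim f x - f (grid_proj n x)|.
  by apply: cvg_norm; apply: cvgB; [exact: grid_lim_cvg | exact: cvg_cst].
move=> /cvgr_to_le; apply.
exists n => // N /= nN; apply: le_trans (chaining_levels K_ge0 hK nN cx) _.
by rewrite ler_wpM2l// lerB.
Qed.

Let pair_cvg x y : cube x -> cube y ->
  `|f (grid_proj N x) - f (grid_proj N y)| @[N --> \oo] -->
  `|grid_lim f x - grid_lim f y|.
Proof. by move=> cx cy; apply: cvg_norm; apply: cvgB; exact: grid_lim_cvg. Qed.

Lemma grid_lim_pair n x y : cube x -> cube y ->
  (forall i, `|x ord0 i - y ord0 i| <= 2 ^- n) ->
  `|grid_lim f x - grid_lim f y| <= 2 * d%:R * (limn S - S n).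
Proof.
move=> cx cy xy; apply: cvgr_to_le (pair_cvg cx cy) _.
exists n => // N /= nN; apply: le_trans (chaining_pair K_ge0 hK nN cx cy xy) _.
by rewrite ler_wpM2l ?mulr_ge0// lerB.
Qed.

Lemma grid_lim_holder (v : nat -> R) (alpha M : R) n x y :
  0 < alpha -> (forall m, 0 < v m) -> (forall m, v m.+1 <= v m) ->
  (forall m, \sum_(i < m) K i * v i `^ (- alpha) <= M) ->
  cube x -> cube y -> (forall i, `|x ord0 i - y ord0 i| <= 2 ^- n) ->
  `|grid_lim f x - grid_lim f y| * v n `^ (- alpha) <= 2 * d%:R * M.
Proof.
move=> al0 v0 vle hM cx cy xy.
apply: cvgr_to_le (cvgM (pair_cvg cx cy) (cvg_cst (v n `^ (- alpha)))) _.
exists n => // N /= nN; exact: (chaining_holder K_ge0 hK al0 v0 vle hM cx cy nN xy).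
Qed.

Lemma grid_lim_continuous : {within @cube R d, continuous (grid_lim f)}.
Proof.
apply/subspace_continuousP => x cx; apply/cvgrPdist_lt => e e0.
have [n _ /(_ n (leqnn n)) hn] := tail_small e0.
apply/nbhs_ballP; exists (2 ^- n) => /=; first exact: dyadic_gt0.
move=> y xy cy; apply: le_lt_trans hn; apply: grid_lim_pair => // i.
by case: xy => _ /(_ ord0 i) /ltW.
Qed.

End GridLimit.

(** * Measurability of limits *)

Section BorelLimit.
Context {R : realType} {disp : measure_display} {Omega : measurableType disp}.
Context {V : normedModType R}.
Local Notation borel := (g_sigma_algebraType (@open V)).

(* With [F_k] the closed set of points at distance at least [1/k] from the
   complement of an open [U], the limit lies in [U] iff for some [k] the
   sequence is eventually in [F_k]. *)
Lemma measurable_fun_cvg_borel (h : nat -> Omega -> V) (f : Omega -> V) :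
  (forall n, measurable_fun setT (h n : Omega -> borel)) ->
  (forall w, h n w @[n --> \oo] --> f w) ->
  measurable_fun setT (f : Omega -> borel).
Proof.
move=> mh hf; apply: (@measurability _ _ _ borel _ _ (@open V)) => //.
move=> _ [U oU <-]; rewrite setTI.
pose F k := ~` \bigcup_(z in ~` U) ball z (k.+1%:R^-1 : R).
have mF n k : measurable (h n @^-1` F k).
  rewrite -[_ @^-1` _]setTI; apply: (mh n) => //; apply: measurableC.
  apply: sub_sigma_algebra; apply: bigcup_open => z _; exact: ball_open.
have -> : f @^-1` U =
    \bigcup_k \bigcup_N \bigcap_(n in [set n | (N <= n)%N]) (h n @^-1` F k).
  apply/seteqP; split=> [w /= Uw|w [k _ [N _ hN]]].
    have /nbhs_ballP[e /= e0 eU] := open_nbhs_nbhs (conj oU Uw).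
    have e20 : 0 < e / 2 by rewrite divr_gt0.
    pose k := Num.truncn (e / 2)^-1.
    have ke : k.+1%:R^-1 < e / 2.
      by rewrite invf_plt ?posrE ?ltr0n// truncnS_gt.
    have /cvgrPdist_lt /(_ _ e20) [N _ hN] := hf w.
    exists k => //; exists N => // n Nn [z nUz]; apply: contra_not nUz.
    rewrite -ball_normE/= distrC => zh.
    apply: eU; rewrite -ball_normE/=; have := hN n Nn => /= fh.
    by rewrite (le_lt_trans (ler_distD (h n w) _ _))// [ltRHS]splitr ltrD// (lt_trans zh).
  have k0 : 0 < k.+1%:R^-1 :> R by rewrite invr_gt0 ltr0n.
  have /cvgrPdist_lt /(_ _ k0) [M _ hM] := hf w.
  apply: contrapT => nU; have /= := hN (maxn N M) (leq_maxl _ _); apply.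
  by exists (f w) => //; rewrite -ball_normE/=; apply: hM; exact: leq_maxr.
apply: bigcup_measurable => k _; apply: bigcup_measurable => N _.
by apply: bigcap_measurableType => n _; exact: mF.
Qed.

End BorelLimit.

(** * Increments over the grids *)

Lemma le_term_sume {R : realType} {I : finType} (F : I -> \bar R) (i : I) :
  (forall j, 0 <= F j)%E -> (F i <= \sum_j F j)%E.
Proof. by move=> F0; rewrite (bigD1 i)//= leeDl// sume_ge0. Qed.

Section FieldEnergy.
Context {R : realType} {disp : measure_display} {Omega : measurableType disp}.
Context (P : probability Omega R) {H : completeNormedModType R} {d : nat}.
Context (X : R -> 'rV[R]_d -> Omega -> H) (gamma : R) (v : nat -> R).
Local Notation incr := (sup_increment X gamma).
Implicit Types (x y : 'rV[R]_d) (w : Omega).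

Lemma sup_increment_ub t x y w : `[0, 1]%classic t ->
  ((`|X t x w - X t y w| `^ gamma)%:E <= incr x y w)%E.
Proof. by move=> t01; apply: ereal_sup_ubound; exists t. Qed.

Lemma sup_increment_ge0 x y w : (0 <= incr x y w)%E.
Proof.
apply: le_trans (@sup_increment_ub 0 x y w _); first by rewrite lee_fin powR_ge0.
by rewrite /= in_itv/= lexx ler01.
Qed.

Definition level_energy n w : \bar R :=
  (\sum_(a : {ffun 'I_d -> 'I_(2 ^ n).+1}) \sum_(i < d)
    incr (grid n (fun j => a j : nat)) (grid n (shift_axis (fun j => a j : nat) i)) w)%E.

Definition field_energy alpha w : \bar R :=
  (\sum_(0 <= n <oo)
    (v n `^ (chaining_exponent gamma alpha - 1))%:E * level_energy n w)%E.

(** [fine] sends an infinite energy to 0, so this bounds the increments only where the energy of the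
    level is finite. *)
Definition level_bound n w : R := fine (level_energy n w) `^ gamma^-1.

Lemma level_energy_ge0 n w : (0 <= level_energy n w)%E.
Proof. by apply: sume_ge0 => a _; apply: sume_ge0 => i _; exact: sup_increment_ge0. Qed.

Lemma field_energy_ge0 alpha w : (0 <= field_energy alpha w)%E.
Proof.
apply: nneseries_ge0 => n _ _; apply: mule_ge0; last exact: level_energy_ge0.
by rewrite lee_fin powR_ge0.
Qed.

Context (gamma_gt0 : 0 < gamma) (v_gt0 : forall n, 0 < v n).

Lemma level_boundP n w t a i : level_energy n w \is a fin_num ->
  `[0, 1]%classic t ->
  `|X t (grid n a) w - X t (grid n (shift_axis a i)) w| <= level_bound n w.
Proof.
move=> fin t01.
pose b : {ffun 'I_d -> 'I_(2 ^ n).+1} := [ffun j => inord (minn (2 ^ n) (a j))].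
have bE : (fun j => b j : nat) = (fun j => minn (2 ^ n) (a j)).
  by apply/funext => j; rewrite ffunE inordK// ltnS geq_minl.
have -> : grid n a = grid n (fun j => b j : nat) :> 'rV[R]_d by rewrite bE -grid_clamp.
have -> : grid n (shift_axis a i) = grid n (shift_axis (fun j => b j : nat) i) :> 'rV[R]_d.
  (* Clamping does not commute with the shift, but the two orders agree after a further clamping. *)
  rewrite bE grid_clamp [RHS]grid_clamp; congr grid; apply/funext => j.
  by rewrite /shift_axis; case: eqP => _; lia.
set z := `|_|; have -> : z = (z `^ gamma) `^ gamma^-1.
  by rewrite -powRrM divff ?gt_eqF// powRr1 ?normr_ge0.
apply: ge0_ler_powR; rewrite ?nnegrE ?powR_ge0 ?fine_ge0 ?level_energy_ge0
  ?invr_ge0 ?(ltW gamma_gt0)//.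
rewrite -lee_fin fineK//; apply: le_trans (sup_increment_ub _ _ _ t01) _.
rewrite /level_energy.
apply: le_trans (le_term_sume b _); last first.
  by move=> c; apply: sume_ge0 => j _; exact: sup_increment_ge0.
apply: (le_term_sume i (F := fun i => incr (grid n (fun j => b j : nat))
  (grid n (shift_axis (fun j => b j : nat) i)) w)) => j.
exact: sup_increment_ge0.
Qed.

Lemma field_energy_level alpha n w : (field_energy alpha w < +oo)%E ->
  level_energy n w \is a fin_num.
Proof.
move=> fin; rewrite ge0_fin_numE ?level_energy_ge0//.
have := level_energy_ge0 n w; rewrite le_eqVlt ltey => _.
apply: contraTN fin => /eqP lev; rewrite -leNgt leye_eq /field_energy.
apply/eqP/(@eseries_pinfty _ _ _ n) => //.
  move=> k _; rewrite gt_eqF// (lt_le_trans (ltNyr 0))// mule_ge0 ?level_energy_ge0//.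
  by rewrite lee_fin powR_ge0.
by rewrite lev gt0_muley// lte_fin powR_gt0.
Qed.

Lemma level_bound_sum alpha W :
  (forall N, \sum_(i < N) v i `^ chaining_exponent gamma alpha <= W) ->
  exists2 A, 0 < A & forall w, (field_energy alpha w < +oo)%E ->
    forall N, \sum_(i < N) level_bound i w * v i `^ (- alpha) <=
      (A * fine (field_energy alpha w)) `^ gamma^-1.
Proof.
move=> hW; have [A A_gt0 hA] := chaining_powR_le gamma_gt0 v_gt0 hW.
exists A => // w fin N.
have K_ge0 n : 0 <= level_bound n w by exact: powR_ge0.
set z := \sum_(i < N) _; have z0 : 0 <= z.
  by apply: sumr_ge0 => i _; rewrite mulr_ge0 ?powR_ge0.
rewrite -[z]powRr1// -(divff (lt0r_neq0 gamma_gt0)) powRrM.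
apply: ge0_ler_powR; rewrite ?nnegrE ?powR_ge0 ?invr_ge0 ?(ltW gamma_gt0)//.
  by rewrite mulr_ge0 ?(ltW A_gt0)// fine_ge0 ?field_energy_ge0.
apply: le_trans (hA _ N K_ge0) _; rewrite ler_pM2l// -lee_fin fineK; last first.
  by rewrite ge0_fin_numE ?field_energy_ge0.
have -> : (\sum_(i < N) v i `^ (chaining_exponent gamma alpha - 1) *
    level_bound i w `^ gamma)%:E = (\sum_(0 <= i < N)
    (v i `^ (chaining_exponent gamma alpha - 1))%:E * level_energy i w)%E.
  rewrite big_mkord -sumEFin; apply: eq_bigr => i _; rewrite EFinM; congr (_ * _)%E.
  rewrite /level_bound -powRrM mulVf ?gt_eqF// powRr1 ?fine_ge0 ?level_energy_ge0//.
  by rewrite fineK// (field_energy_level _ fin).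
apply: nneseries_lim_ge => n _ _; apply: mule_ge0; last exact: level_energy_ge0.
by rewrite lee_fin powR_ge0.
Qed.

Context (incr_meas : forall x y, cube x -> cube y -> measurable_fun setT (incr x y)).

Lemma measurable_level_energy n : measurable_fun setT (level_energy n).
Proof.
apply: emeasurable_sum => a; apply: emeasurable_sum => i.
by apply: incr_meas; exact: grid_cube.
Qed.

Lemma measurable_field_energy alpha : measurable_fun setT (field_energy alpha).
Proof.
apply: ge0_emeasurable_sum => [k w _ _|k _].
  by apply: mule_ge0; rewrite ?level_energy_ge0// lee_fin powR_ge0.
by apply: emeasurable_funM => //; exact: measurable_level_energy.
Qed.

Context (C : R) (C_ge0 : 0 <= C) (psi : R -> R) (d_gt0 : (0 < d)%N).
Context (vE : forall n, v n = psi (2 ^- n)).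
Context (incr_bound : forall x y, cube x -> cube y ->
  (\int[P]_w incr x y w <= (C * enorm (x - y) ^+ d * psi (enorm (x - y)))%:E)%E).

(** There are [d (2^n + 1)^d] edges, each of expected energy at most [C 2^(-n d) v_n], and
    [(2^n + 1) 2^-n <= 2]. *)
Lemma integral_level_energy n :
  (\int[P]_w level_energy n w <= (C * d%:R * 2 ^+ d * v n)%:E)%E.
Proof.
rewrite ge0_integral_sum//; first last.
  by move=> a w _; apply: sume_ge0 => i _; exact: sup_increment_ge0.
  by move=> a; apply: emeasurable_sum => i; apply: incr_meas; exact: grid_cube.
apply: (@le_trans _ _ (\sum_(a : {ffun 'I_d -> 'I_(2 ^ n).+1}) \sum_(i < d)
    (C * (2 ^- n) ^+ d * v n)%:E)%E).
  apply: lee_sum => a _; rewrite ge0_integral_sum//; first last.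
    by move=> i w _; exact: sup_increment_ge0.
    by move=> i; apply: incr_meas; exact: grid_cube.
  apply: lee_sum => i _.
  apply: le_trans (incr_bound (grid_cube _ _) (grid_cube _ _)) _.
  rewrite lee_fin.
  have [->|->] := @shift_axis_dist R d n (fun j => a j : nat) i.
    rewrite subrr /enorm big1 ?sqrtr0 => [|j _]; last by rewrite mxE expr0n.
    (* A degenerate edge contributes nothing because [0^d = 0] for [d >= 1]. *)
    rewrite expr0n gtn_eqF// mulr0 mul0r.
    by rewrite !mulr_ge0 ?exprn_ge0 ?(ltW (dyadic_gt0 _)) ?(ltW (v_gt0 _)).
  by rewrite vE.
under eq_bigr do rewrite sumEFin; rewrite sumEFin lee_fin.
rewrite !sumr_const card_ffun !card_ord.
have v0 := v_gt0 n; set c := (2 ^ n).+1.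
have -> : C * (2 ^- n) ^+ d * v n *+ d *+ (c ^ d)%N =
    (C * d%:R * v n) * (c%:R * 2 ^- n) ^+ d.
  rewrite exprMn -(natrX _ c) -[LHS]mulr_natl -[X in _ * X = _]mulr_natl.
  by move: (c ^ d)%N%:R (d%:R) => p q; set e := _ ^+ d; ring.
rewrite [leRHS]mulrAC; apply: ler_wpM2l; first by rewrite !mulr_ge0 ?(ltW v0).
have p0 : 0 < 2 ^+ n :> R by rewrite exprn_gt0.
rewrite lerXn2r ?nnegrE ?mulr_ge0 ?invr_ge0 ?(ltW p0)//.
rewrite ler_pdivrMr// /c -natr1 natrX.
by have : 1 <= 2 ^+ n :> R by [rewrite exprn_ege1// ler1n]; lra.
Qed.

Lemma integral_field_energy alpha W :
  (forall N, \sum_(i < N) v i `^ chaining_exponent gamma alpha <= W) ->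
  (\int[P]_w field_energy alpha w < +oo)%E.
Proof.
move=> hW; pose D := C * d%:R * 2 ^+ d.
have D0 : 0 <= D by rewrite !mulr_ge0// exprn_ge0.
apply: (@le_lt_trans _ _ (D * W)%:E); last by rewrite ltry.
rewrite integral_nneseries//; first last.
  by move=> n w _; apply: mule_ge0; rewrite ?level_energy_ge0// lee_fin powR_ge0.
  by move=> n; apply: emeasurable_funM => //; exact: measurable_level_energy.
apply: lime_le.
  apply: is_cvg_nneseries => n _ _; apply: integral_ge0 => w _.
  by apply: mule_ge0; rewrite ?level_energy_ge0// lee_fin powR_ge0.
apply: nearW => N.
apply: (@le_trans _ _ (\sum_(0 <= i < N) (D * v i `^ chaining_exponent gamma alpha)%:E)%E).
  apply: lee_sum => n _; rewrite ge0_integralZl_EFin ?powR_ge0//; first last.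
    exact: measurable_level_energy.
    by move=> w _; exact: level_energy_ge0.
  have := integral_level_energy n; rewrite -/D => /(lee_wpmul2l _) h.
  apply: le_trans (h (_ `^ _)%:E _) _; first by rewrite lee_fin powR_ge0.
  rewrite -EFinM lee_fin mulrCA ler_wpM2l// -[X in _ * X]powRr1 ?(ltW (v_gt0 n))//.
  by rewrite -powRD ?subrK// (gt_eqF (v_gt0 n)) implybT.
rewrite sumEFin lee_fin -mulr_sumr ler_wpM2l// big_mkord.
exact: hW.
Qed.

End FieldEnergy.

(** * The modification *)

Lemma nneseries_lty_small {R : realType} (u : nat -> \bar R) (e : R) : 0 < e ->
  (forall n, (0 <= u n)%E) -> (\sum_(0 <= n <oo) u n < +oo)%E ->
  exists N, forall n, (N <= n)%N -> (u n < e%:E)%E.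
Proof.
move=> e0 u0 ufin.
have sfin : (\sum_(0 <= n <oo) u n)%E \is a fin_num.
  by rewrite ge0_fin_numE// nneseries_ge0.
have ufn n : u n \is a fin_num.
  rewrite ge0_fin_numE//; apply: le_lt_trans ufin.
  apply: le_trans (nneseries_lim_ge n.+1 _); last by [].
  by rewrite big_mkord big_ord_recr/= leeDr// sume_ge0.
have : cvgn (series (fine \o u)).
  apply: nondecreasing_is_cvgn.
    by apply/nondecreasing_seqP => n; rewrite seriesSr/= lerDl fine_ge0.
  exists (fine (\sum_(0 <= n <oo) u n)%E) => _ [n _ <-].
  rewrite -lee_fin fineK// /series/= -sumEFin.
  apply: le_trans (nneseries_lim_ge n _); last by [].
  by under eq_bigr do rewrite fineK//.
move=> /cvg_series_cvg_0 /cvgrPdist_lt /(_ e e0) [N _ hN]; exists N => n Nn.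
have := hN n Nn; rewrite /= sub0r normrN ger0_norm ?fine_ge0// => h.
by rewrite -(fineK (ufn n)) lte_fin.
Qed.

Section Modification.
Context {R : realType} {disp : measure_display} {Omega : measurableType disp}.
Context (P : probability Omega R) {H : completeNormedModType R} {d : nat}.
Context (d_gt0 : (0 < d)%N) (X : R -> 'rV[R]_d -> Omega -> H).
Context (X_field : stochastic_field X) (gamma : R) (gamma_gt0 : 0 < gamma).
Local Notation incr := (sup_increment X gamma).
Context (incr_meas : forall x y, cube x -> cube y -> measurable_fun setT (incr x y)).
Context (psi : R -> R) (psi_gt0 : forall r, 0 < r -> 0 < psi r).
Context (psi_le : forall r s, 0 < r -> r <= s -> psi r <= psi s).
Context (psi_right_usc : forall r e, 0 < r -> 0 < e ->
  exists2 delta, 0 < delta & forall s, s < r + delta -> psi s < psi r + e).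
Context (psi_doubling :
  exists2 c, 0 < c & forall n, psi (2 ^- n) <= c * psi (2 ^- n.+1)).
Context (C : R) (C_ge0 : 0 <= C).
Context (incr_bound : forall x y, cube x -> cube y ->
  (\int[P]_w incr x y w <= (C * enorm (x - y) ^+ d * psi (enorm (x - y)))%:E)%E).
Context (alpha0 : R) (alpha0_gt0 : 0 < alpha0).
Context (psi_summable : forall alpha, 0 < alpha <= alpha0 ->
  exists W, forall N, \sum_(i < N) psi (2 ^- i) `^ chaining_exponent gamma alpha <= W).
Implicit Types (x y : 'rV[R]_d) (w : Omega).

Local Notation v := (fun n : nat => psi (2 ^- n)).
Local Notation energy := (field_energy X gamma v).
Local Notation K w := (fun n => level_bound X gamma n w).

Let v_gt0 n : 0 < v n. Proof. exact/psi_gt0/dyadic_gt0. Qed.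

Let v_le n : v n.+1 <= v n.
Proof.
by apply: psi_le; [exact: dyadic_gt0 | exact: dyadic_le].
Qed.

Let K_ge0 w n : 0 <= K w n. Proof. exact: powR_ge0. Qed.

Let cube0 : @cube R d 0.
Proof. by move=> i; rewrite mxE lexx ler01. Qed.

Definition chaining_event : set Omega := [set w | energy alpha0 w < +oo]%E.

Local Notation G := chaining_event.

Let measurable_G : measurable G.
Proof.
rewrite /G -[X in measurable X]setTI; apply: emeasurable_fun_infty_o => //.
exact: measurable_field_energy.
Qed.

Let lty_ae (f : Omega -> \bar R) : measurable_fun setT f -> (forall w, 0 <= f w)%E ->
  (\int[P]_w f w < +oo)%E -> {ae P, forall w, (f w < +oo)%E}.
Proof.
move=> mf f0 fi; have : P.-integrable setT f.
  by apply/integrableP; split => //; under eq_integral do rewrite gee0_abs//.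
move=> /(integrable_ae measurableT); apply: filterS => w /(_ I).
by rewrite ge0_fin_numE.
Qed.

Let G_ae : {ae P, forall w, G w}.
Proof.
have [|W hW] := psi_summable (alpha := alpha0); first by rewrite alpha0_gt0 lexx.
apply: lty_ae => [|w|]; first exact: measurable_field_energy.
  exact: field_energy_ge0.
by apply: (integral_field_energy v_gt0 incr_meas C_ge0 d_gt0 _ incr_bound hW).
Qed.

Let K_chain w t : G w -> `[0, 1]%classic t -> forall n a i,
  `|X t (grid n a) w - X t (grid n (shift_axis a i)) w| <= K w n.
Proof.
move=> Gw t01 n a i; apply: (level_boundP gamma_gt0) => //.
exact: (field_energy_level (v := v) v_gt0 n Gw).
Qed.

(** Since [v_i <= v_0], the factor [v_0^alpha0 v_i^-alpha0] is at least 1, and the weighted sum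
    dominates the plain one. *)
Let K_cvg w : G w -> cvgn (fun n => \sum_(i < n) K w i).
Proof.
move=> Gw.
have [|W hW] := psi_summable (alpha := alpha0); first by rewrite alpha0_gt0 lexx.
have [A A_gt0 hA] := level_bound_sum X gamma_gt0 v_gt0 hW.
apply: nondecreasing_is_cvgn.
  by apply/nondecreasing_seqP => n; rewrite big_ord_recr/= lerDl.
exists ((A * fine (energy alpha0 w)) `^ gamma^-1 * v 0 `^ alpha0) => _ [n _ <-].
apply: le_trans (ler_wpM2r (powR_ge0 _ _) (hA w Gw n)); rewrite mulr_suml.
apply: ler_sum => i _; rewrite -mulrA ler_peMr// powRN mulrC.
rewrite ler_pdivlMr ?powR_gt0// mul1r; apply: ge0_ler_powR.
- exact: ltW.
- by rewrite nnegrE ltW.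
- by rewrite nnegrE ltW.
- by elim: (i : nat) => // k; apply: le_trans; exact: v_le.
Qed.

(* Off the event the values at [0] are taken for every [x]: then [Xt] agrees with
   [X] at [x] iff [incr x 0] vanishes, which is a measurable condition. *)
Definition modification t x w : H :=
  if w \in G then grid_lim (fun y => X t y w) x else X t 0 w.

Local Notation Xt := modification.

Let XtG t x w : G w -> Xt t x w = grid_lim (fun y => X t y w) x.
Proof. by move=> Gw; rewrite /modification mem_set. Qed.

Let XtnG t x w : ~ G w -> Xt t x w = X t 0 w.
Proof. by move=> Gw; rewrite /modification memNset. Qed.

Let Xt_field : stochastic_field Xt.
Proof.
move=> t x t01 cx.
pose h n w := if w \in G then X t (grid_proj n x) w else X t 0 w.
apply: (@measurable_fun_cvg_borel _ _ _ _ h) => [n|w].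
  apply: measurable_fun_ifT.
  - apply: (measurable_fun_bool true); rewrite setTI.
    rewrite (_ : _ @^-1` _ = G)//.
    by apply/seteqP; split=> w /=; [move/set_mem | move/mem_set].
  - by apply: X_field => //; exact: grid_cube.
  - exact: X_field.
rewrite /h /modification; case: ifPn => [/set_mem Gw|_]; last exact: cvg_cst.
exact: (grid_lim_cvg (K_ge0 w) (K_chain Gw t01) (K_cvg Gw) cx).
Qed.

Let Xt_continuous w t : `[0, 1]%classic t ->
  {within @cube R d, continuous (fun x => Xt t x w)}.
Proof.
move=> t01; have [Gw|nGw] := pselect (G w).
  rewrite (_ : (fun x => _) = grid_lim (fun y => X t y w)).
    exact: (grid_lim_continuous (K_ge0 w) (K_chain Gw t01) (K_cvg Gw)).
  by apply/funext => x; rewrite XtG.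
rewrite (_ : (fun x => _) = fun=> X t 0 w); first exact: cst_continuous.
by apply/funext => x; rewrite XtnG.
Qed.

(** A Borel-Cantelli argument at a fixed [x]: the distance to the [n]-th approximation is at most
    [d 2^-n], so its [d]-th power is at most [d^d 2^-n] and the expected increments are summable. *)
Let grid_incr_small x : cube x -> {ae P, forall w, forall e : R, 0 < e ->
  exists N, forall n, (N <= n)%N -> (incr x (grid_proj n x) w < e%:E)%E}.
Proof.
move=> cx; pose U w := (\sum_(0 <= n <oo) incr x (grid_proj n x) w)%E.
have mincr n : measurable_fun setT (incr x (grid_proj n x)).
  by apply: incr_meas => //; exact: grid_cube.
have mU : measurable_fun setT U.
  by apply: ge0_emeasurable_sum => // k w _ _; exact: sup_increment_ge0.
have dR : 0 < d%:R :> R by rewrite ltr0n.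
pose D := C * d%:R ^+ d * psi d%:R.
have D0 : 0 <= D by rewrite !mulr_ge0 ?exprn_ge0 ?(ltW dR)// ltW// psi_gt0.
have UI : (\int[P]_w U w < +oo)%E.
  apply: (@le_lt_trans _ _ (D * 2)%:E); last by rewrite ltry.
  rewrite integral_nneseries//; last by move=> n w _; exact: sup_increment_ge0.
  apply: lime_le.
    apply: is_cvg_nneseries => n _ _; apply: integral_ge0 => w _.
    exact: sup_increment_ge0.
  apply: nearW => N; apply: (@le_trans _ _ (\sum_(0 <= n < N) (D * 2 ^- n)%:E)%E).
    apply: lee_sum => n _; apply: le_trans (incr_bound cx (grid_cube _ _)) _.
    rewrite lee_fin -/(grid_proj n x).
    have := grid_proj_dist n cx; set r := enorm _ => rn.
    have r0 : 0 <= r by exact: enorm_ge0.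
    have n0 := @dyadic_gt0 R n.
    (* The monotonicity of [psi] is available only at positive arguments, so coincidence of [x] with
       its approximation is treated apart. *)
    have [->|rn0] := eqVneq r 0.
      by rewrite expr0n gtn_eqF// mulr0 mul0r mulr_ge0// ltW.
    have n1 : 2 ^- n <= 1 :> R.
      by rewrite invf_le1 ?exprn_gt0// exprn_ege1// ler1n.
    have rd : r <= d%:R by apply: le_trans rn _; rewrite -[leRHS]mulr1 ler_pM2l.
    rewrite /D [leRHS]mulrAC; apply: ler_pM.
    - by rewrite mulr_ge0 ?exprn_ge0.
    - by rewrite ltW// psi_gt0// lt_neqAle eq_sym rn0.
    - rewrite -mulrA ler_wpM2l//; apply: (@le_trans _ _ ((d%:R * 2 ^- n) ^+ d)).
        by rewrite lerXn2r ?nnegrE// mulr_ge0 ?(ltW dR) ?(ltW n0).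
      rewrite exprMn ler_wpM2l ?exprn_ge0 ?(ltW dR)//.
      case: (d) d_gt0 => // k _; rewrite exprS ler_piMr ?(ltW n0)//.
      by rewrite exprn_ile1// ltW.
    - by rewrite psi_le// lt_neqAle eq_sym rn0.
  rewrite sumEFin lee_fin -mulr_sumr ler_wpM2l// big_mkord.
  suff : \sum_(i < N) 2 ^- i <= 2 - 2 * 2 ^- N :> R.
    by move=> /le_trans; apply; rewrite gerBl mulr_ge0// ltW// dyadic_gt0.
  elim: N => [|N IH]; first by rewrite big_ord0 expr0 invr1 mulr1 subrr.
  rewrite big_ord_recr/= exprS invfM mulrA divff ?mul1r ?pnatr_eq0//; lra.
have := lty_ae mU _ UI; have U0 w : (0 <= U w)%E.
  by apply: nneseries_ge0 => n _ _; exact: sup_increment_ge0.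
move=> /(_ U0); apply: filterS => w Uw e e0.
apply: nneseries_lty_small => // n; exact: sup_increment_ge0.
Qed.

(** The event that [X t] at the approximations of [x] tends to [X t x] uniformly in [t], written
    with countable operations on measurable increments. *)
Let small_event x : set Omega := \bigcap_k \bigcup_N
  \bigcap_(n in [set n | (N <= n)%N])
    [set w | incr x (grid_proj n x) w < (k.+1%:R^-1)%:E]%E.

Let measurable_small_event x : cube x -> measurable (small_event x).
Proof.
move=> cx; apply: bigcap_measurableType => k _; apply: bigcup_measurable => N _.
apply: bigcap_measurableType => n _; rewrite -[X in measurable X]setTI.
by apply: emeasurable_fun_infty_o => //; apply: incr_meas => //; exact: grid_cube.
Qed.

Let small_eventP x w : small_event x w <-> forall e : R, 0 < e ->
  exists N, forall n, (N <= n)%N -> (incr x (grid_proj n x) w < e%:E)%E.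
Proof.
split=> [h e e0|h k _]; last first.
  have [|N hN] := h k.+1%:R^-1; first by rewrite invr_gt0 ltr0n.
  by exists N => // n /= /hN.
have [N _ hN] := h (Num.truncn e^-1) I; exists N => n Nn.
apply: lt_trans (hN n Nn) _; rewrite lte_fin invf_plt ?posrE ?ltr0n//.
exact: truncnS_gt.
Qed.

Let norm_lt_powR (z e : R) : 0 <= z -> 0 < e -> z `^ gamma < e `^ gamma -> z < e.
Proof.
move=> z0 e0; apply: contraTT; rewrite -!leNgt => ez.
by apply: ge0_ler_powR; rewrite ?nnegrE ?(ltW gamma_gt0) ?(ltW e0).
Qed.

(** On the event, the approximations converge to [Xt] uniformly in [t] with the tail of the sum of
    [K] as rate. Agreement therefore forces the increments of [X] to vanish in the limit;
    conversely, limits are unique. *)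
Let agree_on x w : cube x -> G w ->
  (forall t, `[0, 1]%classic t -> Xt t x w = X t x w) <-> small_event x w.
Proof.
move=> cx Gw; rewrite small_eventP; split=> [agree e e0|small t t01].
  pose S n := \sum_(i < n) K w i; pose tail n := d%:R * (limn S - S n.+1).
  have tail_cvg : tail n @[n --> \oo] --> 0.
    rewrite -(mulr0 d%:R) -(subrr (limn S)); apply: cvgM; first exact: cvg_cst.
    apply: cvgB; first exact: cvg_cst.
    by have := K_cvg Gw; rewrite -(cvg_shiftS S).
  have r0 : 0 < e `^ gamma^-1 by rewrite powR_gt0.
  have /cvgrPdist_lt /(_ _ r0) [N _ hN] := tail_cvg.
  exists N => n /hN /=; rewrite sub0r normrN => tn.
  apply: (@le_lt_trans _ _ (`|tail n| `^ gamma)%:E).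
    apply: ge_ereal_sup => _ [t t01 <-]; rewrite lee_fin.
    apply: ge0_ler_powR; rewrite ?nnegrE ?(ltW gamma_gt0)//.
    rewrite -agree// XtG//; apply: le_trans (ler_norm _).
    exact: (grid_lim_tail (K_ge0 w) (K_chain Gw t01) (K_cvg Gw) n cx).
  have -> : e = (e `^ gamma^-1) `^ gamma.
    by rewrite -powRrM mulVf ?gt_eqF// powRr1// ltW.
  by rewrite lte_fin; apply: gt0_ltr_powR; rewrite ?nnegrE ?(ltW r0).
rewrite XtG//; apply/cvg_lim => //; apply/cvgrPdist_lt => e e0.
have [|N hN] := small (e `^ gamma); first by rewrite powR_gt0.
exists N => // n /= /hN h; apply: norm_lt_powR => //.
by rewrite -lte_fin; apply: le_lt_trans h; exact: sup_increment_ub.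
Qed.

Let agree_off x w : cube x -> ~ G w ->
  (forall t, `[0, 1]%classic t -> Xt t x w = X t x w) <-> incr x 0 w = 0%E.
Proof.
move=> cx nGw; split=> [agree|incr0 t t01].
  apply/eqP; rewrite eq_le sup_increment_ge0 andbT.
  apply: ge_ereal_sup => _ [t t01 <-].
  by rewrite -agree// XtnG// subrr normr0 powR0// gt_eqF.
rewrite XtnG//; apply/esym/eqP; rewrite -subr_eq0 -normr_eq0; apply/eqP.
apply: (@powR_eq0_eq0 _ _ gamma); apply/eqP; rewrite eq_le powR_ge0 andbT.
by have := sup_increment_ub X gamma x 0 w t01; rewrite incr0 lee_fin distrC.
Qed.

Let Xt_realization : is_realization P X Xt.
Proof.
split=> // x cx A; have AE : A = (G `&` small_event x) `|`
    (~` G `&` [set w | incr x 0 w = 0%E]).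
  apply/seteqP; split=> w /=.
    have [Gw /(agree_on cx Gw)|nGw /(agree_off cx nGw)] := pselect (G w); first by left.
    by right.
  by case=> -[Gw]; [move/(agree_on cx Gw) | move/(agree_off cx Gw)].
have mA : measurable A.
  rewrite AE; apply: measurableU; apply: measurableI => //.
  - exact: measurable_small_event.
  - exact: measurableC.
  - rewrite -[X in measurable X]setTI.
    exact: (incr_meas cx cube0 measurableT (emeasurable_set1 0%E)).
split=> //.
suff : P (~` A) = 0%E.
  by rewrite probability_setC// => /eqP; rewrite sube_eq ?fin_num_measure//
    ?add0e ?addye// => /eqP.
apply: measure_negligible; first exact: measurableC.
suff : {ae P, forall w, A w} by [].
move: G_ae (grid_incr_small cx); apply: filterS2 => w Gw small.
by rewrite AE; left; split=> //; apply/small_eventP.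
Qed.

(** * Expectation of the seminorm *)

Let holder_ratio alpha (f : 'rV[R]_d -> H) x y :=
  `|f x - f y| / psi (enorm (x - y)) `^ alpha.

Let holder_ratio_ge0 alpha f x y : 0 <= holder_ratio alpha f x y.
Proof. by rewrite divr_ge0 ?powR_ge0. Qed.

(** An empty supremum would be [-oo]; as [d >= 1], the opposite corners of the cube form a pair of
    distinct points. *)
Let holder_seminorm_ge0 alpha (f : 'rV[R]_d -> H) :
  (0 <= holder_seminorm alpha psi f)%E.
Proof.
apply: (@le_trans _ _ (holder_ratio alpha f 0 (const_mx 1))%:E).
  by rewrite lee_fin holder_ratio_ge0.
apply: ereal_sup_ubound; exists 0, (const_mx 1); split=> //.
  by move=> i; rewrite mxE ler01 lexx.
by move=> /rowP/(_ (Ordinal d_gt0))/eqP; rewrite !mxE eq_sym oner_eq0.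
Qed.

Let sup_holder_le alpha (Y : R -> 'rV[R]_d -> Omega -> H) w (M : \bar R) :
  (0 <= M)%E ->
  (forall t x y, `[0, 1]%classic t -> cube x -> cube y -> x <> y ->
    ((holder_ratio alpha (fun x => Y t x w) x y `^ gamma)%:E <= M)%E) ->
  (sup_holder Y gamma alpha psi w <= M)%E.
Proof.
case: M => [m|_ _|]; rewrite ?leey// lee_fin => m0 h.
apply: ge_ereal_sup => _ [t t01 <-].
have -> : m%:E = ((m `^ gamma^-1)%:E `^ gamma)%E.
  by rewrite poweR_EFin -powRrM mulVf ?gt_eqF// powRr1.
apply: gt0_ler_poweR; rewrite ?(ltW gamma_gt0)// ?in_itv/= ?leey ?andbT.
- exact: holder_seminorm_ge0.
- by rewrite lee_fin powR_ge0.
apply: ge_ereal_sup => _ [x [y [cx cy xy ->]]].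
rewrite lee_fin -/(holder_ratio alpha (fun x => Y t x w) x y).
have := h t x y t01 cx cy xy; rewrite lee_fin; set z := holder_ratio _ _ _ _ => zm.
have z0 : 0 <= z by exact: holder_ratio_ge0.
have -> : z = (z `^ gamma) `^ gamma^-1 by rewrite -powRrM mulfV ?gt_eqF// powRr1.
by apply: ge0_ler_powR; rewrite ?nnegrE ?powR_ge0 ?invr_ge0 ?(ltW gamma_gt0).
Qed.

Let le_sup_holder alpha (Y : R -> 'rV[R]_d -> Omega -> H) w t x y :
  `[0, 1]%classic t -> cube x -> cube y -> x <> y ->
  ((holder_ratio alpha (fun x => Y t x w) x y `^ gamma)%:E <=
    sup_holder Y gamma alpha psi w)%E.
Proof.
move=> t01 cx cy xy; rewrite -poweR_EFin.
apply: (@le_trans _ _ (holder_seminorm alpha psi (fun x => Y t x w) `^ gamma)%E).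
  apply: gt0_ler_poweR; rewrite ?(ltW gamma_gt0)// ?in_itv/= ?leey ?andbT.
  - by rewrite lee_fin holder_ratio_ge0.
  - exact: holder_seminorm_ge0.
  - by apply: ereal_sup_ubound; exists x, y.
by apply: ereal_sup_ubound; exists t.
Qed.

Let sup_holder_off alpha w : ~ G w -> sup_holder Xt gamma alpha psi w = 0%E.
Proof.
move=> nGw; apply/eqP; rewrite eq_le; apply/andP; split.
  apply: sup_holder_le => // t x y t01 _ _ _.
  by rewrite /holder_ratio !XtnG// subrr normr0 mul0r powR0// gt_eqF.
apply: ereal_sup_ge; exists (holder_seminorm alpha psi (fun x => Xt 0 x w) `^ gamma)%E.
  by exists 0 => //=; rewrite in_itv/= lexx ler01.
exact: poweR_ge0.
Qed.

Let sup_holder_bound (alpha : R) : 0 < alpha <= alpha0 ->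
  exists2 B : R, 0 < B &
    forall w, (sup_holder Xt gamma alpha psi w <= B%:E * energy alpha w)%E.
Proof.
move=> alpha01; have /andP[alpha_gt0 _] := alpha01.
have [W hW] := psi_summable alpha01.
have [A A_gt0 hA] := level_bound_sum X gamma_gt0 v_gt0 hW.
have [c c_gt0 hc] := psi_doubling.
have dR : 0 < d%:R :> R by rewrite ltr0n.
exists ((c `^ alpha * (2 * d%:R)) `^ gamma * A).
  by rewrite mulr_gt0// powR_gt0// !mulr_gt0// powR_gt0.
set B := _ * A; have B_gt0 : 0 < B.
  by rewrite mulr_gt0// powR_gt0// !mulr_gt0// powR_gt0.
move=> w; have E0 : (0 <= energy alpha w)%E by exact: field_energy_ge0.
have [Gw|nGw] := pselect (G w); last first.
  by rewrite sup_holder_off// mule_ge0// lee_fin ltW.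
(* The event controls the energy for [alpha0] only; if the energy for [alpha] is infinite, the bound
   is trivial because [B > 0]. *)
have := leey (energy alpha w); rewrite le_eqVlt => /predU1P[->|fin].
  by rewrite gt0_muley ?leey// lte_fin.
have e0 : 0 <= fine (energy alpha w) by rewrite fine_ge0.
apply: sup_holder_le => [|t x y t01 cx cy xy].
  by rewrite mule_ge0// lee_fin ltW.
rewrite -(fineK (x := energy alpha w)) ?ge0_fin_numE// -EFinM lee_fin.
set e := fine _ in e0 *; pose M := (A * e) `^ gamma^-1.
have [n [near_xy far_xy]] := dyadic_scale cx cy xy.
set z := holder_ratio _ _ _ _.
(* The factor [2 d] comes from chaining, and [c^alpha] from [psi (2^-n) <= c psi (2^-(n+1)) <= c psi
   (|x - y|)]. *)
have zM : z <= c `^ alpha * (2 * d%:R) * M.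
  have := grid_lim_holder (f := fun y => X t y w) (K_ge0 w) (K_chain Gw t01)
    (K_cvg Gw) alpha_gt0 v_gt0 v_le (hA w fin) cx cy near_xy.
  rewrite -/M /z /holder_ratio !XtG// => h.
  rewrite -[leRHS]mulrA; apply: le_trans (ler_wpM2l (powR_ge0 c alpha) h).
  rewrite mulrCA ler_wpM2l// powRN.
  have r_gt0 : 0 < enorm (x - y) by apply: lt_le_trans far_xy; exact: dyadic_gt0.
  rewrite ler_pdivlMr ?powR_gt0// mulrC ler_pdivrMr ?powR_gt0 ?psi_gt0//.
  rewrite -powRM ?(ltW c_gt0) ?(ltW (psi_gt0 _))//.
  apply: ge0_ler_powR; rewrite ?nnegrE ?mulr_ge0 ?(ltW alpha_gt0) ?(ltW c_gt0)
    ?(ltW (psi_gt0 _)) ?dyadic_gt0//.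
  by apply: le_trans (hc n) _; rewrite ler_pM2l// psi_le// dyadic_gt0.
have := ge0_ler_powR (ltW gamma_gt0) _ _ zM.
rewrite !nnegrE holder_ratio_ge0 => /(_ isT) /(_ _) h.
apply: le_trans (h _) _; first by rewrite !mulr_ge0 ?powR_ge0// ltW.
rewrite powRM ?powR_ge0//; last by rewrite mulr_ge0 ?powR_ge0// mulr_ge0// ltW.
by rewrite -powRrM mulVf ?gt_eqF// powRr1 ?mulr_ge0 ?(ltW A_gt0)// /B -mulrA.
Qed.

(** The pairs are enumerated as a sequence so that their supremum is a countable one; numbers that
    encode nothing give a degenerate pair. *)
Let grid_pair (k : nat) : 'rV[R]_d * 'rV[R]_d :=
  if @unpickle (nat * {ffun 'I_d -> nat} * {ffun 'I_d -> nat})%type k is Some (n, a, b)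
  then (grid n a, grid n b) else (grid 0 (fun=> 0%N), grid 0 (fun=> 0%N)).

Let grid_pairP k : exists n a b, grid_pair k = (grid n a, grid n b).
Proof.
rewrite /grid_pair; case: unpickle => [[[n a] b]|]; first by exists n, a, b.
by exists 0%N, (fun=> 0%N), (fun=> 0%N).
Qed.

Let grid_pair_surj n a b : exists k, grid_pair k = (grid n a, grid n b).
Proof.
have E (c : 'I_d -> nat) : (fun i => [ffun j => c j] i) = c.
  by apply/funext => i; rewrite ffunE.
exists (pickle (n, [ffun j => a j : nat], [ffun j => b j : nat])).
by rewrite /grid_pair pickleK -[in RHS](E a) -[in RHS](E b).
Qed.

(** The supremum over [t] stays inside [incr], which is measurable by hypothesis; only the supremum
    over pairs remains to be taken. *)
Let grid_ratio alpha k w : \bar R :=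
  let: (p, q) := grid_pair k in
  if p == q then 0%E
  else (incr p q w * ((psi (enorm (p - q)) `^ alpha) `^ gamma)^-1%:E)%E.

Let grid_holder alpha w : \bar R := esups (grid_ratio alpha ^~ w) 0%N.

Let measurable_grid_holder alpha : measurable_fun setT (grid_holder alpha).
Proof.
apply: measurable_fun_esups => k; rewrite /grid_ratio.
have [n [a [b ->]]] := grid_pairP k.
case: (grid n a == grid n b) => //=.
by apply: emeasurable_funM => //; apply: incr_meas; exact: grid_cube.
Qed.

Let grid_holder_ub alpha k w : (grid_ratio alpha k w <= grid_holder alpha w)%E.
Proof. by apply: ereal_sup_ubound; exists k. Qed.

Let grid_holder_ge0 alpha w : (0 <= grid_holder alpha w)%E.
Proof.
have [k E] := grid_pair_surj 0 (fun=> 0%N) (fun=> 0%N).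
by apply: le_trans (grid_holder_ub alpha k w); rewrite /grid_ratio E eqxx.
Qed.

Let grid_holder_le alpha w : G w ->
  (grid_holder alpha w <= sup_holder Xt gamma alpha psi w)%E.
Proof.
move=> Gw; apply: ge_ereal_sup => _ [k _ <-]; rewrite /grid_ratio.
have [n [a [b ->]]] := grid_pairP k.
have ca : @cube R d (grid n a) by exact: grid_cube.
have cb : @cube R d (grid n b) by exact: grid_cube.
have [_|/eqP ab] := eqVneq (grid n a) (grid n b).
  apply: (@le_trans _ _ (holder_ratio alpha (fun x => Xt 0 x w) 0 (const_mx 1)
    `^ gamma)%:E); first by rewrite lee_fin powR_ge0.
  apply: le_sup_holder => //.
  - by rewrite /= in_itv/= lexx ler01.
  - by move=> i; rewrite mxE ler01 lexx.
  - by move=> /rowP/(_ (Ordinal d_gt0))/eqP; rewrite !mxE eq_sym oner_eq0.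
have D_gt0 : 0 < psi (enorm (grid n a - grid n b)) `^ alpha.
  by rewrite powR_gt0// psi_gt0// enorm_gt0// subr_eq0; apply/eqP.
rewrite lee_pdivrMr ?(powR_gt0 gamma D_gt0)//; apply: ge_ereal_sup => _ [t t01 <-].
rewrite -lee_pdivrMr ?(powR_gt0 gamma D_gt0)// -EFinM.
have DV : (psi (enorm (grid n a - grid n b)) `^ alpha)^-1 `^ gamma =
    ((psi (enorm (grid n a - grid n b)) `^ alpha) `^ gamma)^-1.
  by rewrite -powR_inv1 ?(ltW D_gt0)// -powRrM mulN1r powRN.
have := le_sup_holder alpha Xt w t01 ca cb ab; rewrite /holder_ratio.
by rewrite powRM ?invr_ge0 ?(ltW D_gt0)// DV !XtG// !grid_lim_grid.
Qed.

(* Every increment of the modification is a limit of increments over the grid,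
   and upper semicontinuity of [psi] from the right suffices to pass to the
   limit in the denominators. *)
Let le_grid_holder (alpha : R) w : 0 < alpha -> G w ->
  (sup_holder Xt gamma alpha psi w <= grid_holder alpha w)%E.
Proof.
move=> alpha_gt0 Gw; apply: sup_holder_le => // t x y t01 cx cy xy.
have Q0 := grid_holder_ge0 alpha w.
have := leey (grid_holder alpha w); rewrite le_eqVlt => /predU1P[->|fin].
  by rewrite leey.
rewrite -(fineK (x := grid_holder alpha w)) ?ge0_fin_numE// lee_fin.
have q0 : 0 <= fine (grid_holder alpha w) by rewrite fine_ge0.
have qE : ((fine (grid_holder alpha w))%:E = grid_holder alpha w)%E.
  by rewrite fineK// ge0_fin_numE.
set q := fine _ in q0 qE *; pose q' := q `^ gamma^-1.
have q'0 : 0 <= q' by exact: powR_ge0.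
have qE' : q = q' `^ gamma by rewrite -powRrM mulVf ?gt_eqF// powRr1.
have r_gt0 : 0 < enorm (x - y) by rewrite enorm_gt0// subr_eq0; apply/eqP.
have grid_le n : `|X t (grid_proj n x) w - X t (grid_proj n y) w| <=
    q' * psi (enorm (grid_proj n x - grid_proj n y)) `^ alpha.
  have [->|/eqP pq] := eqVneq (grid_proj n x) (grid_proj n y).
    by rewrite subrr normr0 mulr_ge0 ?powR_ge0.
  have [k kE] := grid_pair_surj n (fun i => Num.truncn (x ord0 i * 2 ^+ n))
    (fun i => Num.truncn (y ord0 i * 2 ^+ n)).
  have D_gt0 : 0 < psi (enorm (grid_proj n x - grid_proj n y)) `^ alpha.
    by rewrite powR_gt0// psi_gt0// enorm_gt0// subr_eq0; apply/eqP.
  have := grid_holder_ub alpha k w; rewrite /grid_ratio kE -!/(grid_proj _ _).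
  rewrite (negbTE (introN eqP pq)) lee_pdivrMr ?(powR_gt0 gamma D_gt0)// -qE -EFinM => h.
  have := le_trans (sup_increment_ub X gamma _ _ w t01) h.
  rewrite lee_fin qE' -powRM ?(ltW D_gt0)//.
  rewrite !leNgt; apply: contra => lt.
  by apply: gt0_ltr_powR => //; rewrite nnegrE ?mulr_ge0 ?(ltW D_gt0).
have lim_le e : 0 < e ->
    `|Xt t x w - Xt t y w| <= q' * (psi (enorm (x - y)) + e) `^ alpha.
  move=> e0; rewrite !XtG//.
  have cvg z : cube z -> X t (grid_proj n z) w @[n --> \oo] -->
      grid_lim (fun y => X t y w) z.
    exact: (grid_lim_cvg (K_ge0 w) (K_chain Gw t01) (K_cvg Gw)).
  have : `|X t (grid_proj n x) w - X t (grid_proj n y) w| @[n --> \oo] -->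
      `|grid_lim (fun y => X t y w) x - grid_lim (fun y => X t y w) y|.
    by apply: cvg_norm; apply: cvgB; exact: cvg.
  move=> /cvgr_to_le; apply.
  have [delta delta_gt0 hdelta] := psi_right_usc r_gt0 e0.
  have ecvg : enorm (grid_proj n x - grid_proj n y) @[n --> \oo] --> enorm (x - y).
    apply: enorm_cvg => i; have -> : (x - y) ord0 i = x ord0 i - y ord0 i by rewrite !mxE.
    rewrite (_ : (fun n => (grid_proj n x - grid_proj n y) ord0 i) =
      fun n => grid_proj n x ord0 i - grid_proj n y ord0 i); last first.
      by apply/funext => n; rewrite !mxE.
    by apply: cvgB; exact: grid_proj_cvg.
  have /cvgrPdist_lt /(_ _ delta_gt0) := ecvg; apply: filterS => n.
  rewrite ltr_distlC => /andP[_ /hdelta hn].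
  have [pq|/eqP pq] := eqVneq (grid_proj n x) (grid_proj n y).
    by rewrite pq subrr normr0 mulr_ge0 ?powR_ge0.
  apply: le_trans (grid_le n) _; rewrite ler_wpM2l//.
  have p_gt0 : 0 < psi (enorm (grid_proj n x - grid_proj n y)).
    by rewrite psi_gt0// enorm_gt0// subr_eq0; apply/eqP.
  by apply: ge0_ler_powR; rewrite ?nnegrE ?(ltW alpha_gt0) ?(ltW p_gt0)
    ?addr_ge0 ?(ltW e0) ?(ltW (psi_gt0 _))// ltW.
have psi_r := psi_gt0 r_gt0.
rewrite qE'; apply: ge0_ler_powR; rewrite ?nnegrE ?(ltW gamma_gt0)//.
rewrite /holder_ratio ler_pdivrMr ?powR_gt0//.
have [q'E|q'n0] := eqVneq q' 0.
  by have := lim_le 1 ltr01; rewrite q'E !mul0r.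
have {}q'0 : 0 < q' by rewrite lt_neqAle eq_sym q'n0.
rewrite mulrC -ler_pdivrMr//.
set u := _ / q'; have u0 : 0 <= u by rewrite divr_ge0// ltW.
(* Undoing the power [alpha] isolates [psi (|x - y|) + e] on the right, where [e] can be sent to 0
   directly. *)
have -> : u = (u `^ alpha^-1) `^ alpha by rewrite -powRrM mulVf ?gt_eqF// powRr1.
apply: ge0_ler_powR; rewrite ?nnegrE ?powR_ge0 ?(ltW alpha_gt0) ?(ltW psi_r)//.
apply/ler_addgt0Pr => e e0; have pe0 : 0 <= psi (enorm (x - y)) + e.
  by rewrite addr_ge0 ?ltW.
have -> : psi (enorm (x - y)) + e = ((psi (enorm (x - y)) + e) `^ alpha) `^ alpha^-1.
  by rewrite -powRrM divff ?gt_eqF// powRr1.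
apply: ge0_ler_powR; rewrite ?nnegrE ?powR_ge0 ?invr_ge0 ?(ltW alpha_gt0)//.
by rewrite /u ler_pdivrMr// mulrC lim_le.
Qed.

Let measurable_sup_holder (alpha : R) : 0 < alpha ->
  measurable_fun setT (sup_holder Xt gamma alpha psi).
Proof.
move=> alpha_gt0.
have -> : sup_holder Xt gamma alpha psi =
    fun w => if w \in G then grid_holder alpha w else 0%E.
  apply/funext => w; case: ifPn => [/set_mem Gw|/negP nG].
    by apply/eqP; rewrite eq_le le_grid_holder// grid_holder_le.
  by apply: sup_holder_off => Gw; apply: nG; exact/mem_set.
apply: measurable_fun_ifT => //.
apply: (measurable_fun_bool true); rewrite setTI (_ : _ @^-1` _ = G)//.
by apply/seteqP; split=> w /=; [move/set_mem | move/mem_set].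
Qed.

Lemma holder_modification : exists Xt : R -> 'rV[R]_d -> Omega -> H,
  [/\ is_realization P X Xt, continuous_in_x P Xt &
    forall alpha : R, 0 < alpha <= alpha0 ->
      measurable_fun setT (sup_holder Xt gamma alpha psi) /\
      (\int[P]_w sup_holder Xt gamma alpha psi w < +oo)%E].
Proof.
exists Xt; split=> //.
  by apply: aeW => w t; exact: Xt_continuous.
move=> alpha alpha01; have /andP[alpha_gt0 _] := alpha01.
have mh := measurable_sup_holder alpha_gt0; split=> //.
have [B B_gt0 hB] := sup_holder_bound alpha01.
have [W hW] := psi_summable alpha01.
have mE : measurable_fun setT (energy alpha) by exact: measurable_field_energy.
have E0 w : (0 <= energy alpha w)%E by exact: field_energy_ge0.
apply: (@le_lt_trans _ _ (\int[P]_w (B%:E * energy alpha w))%E).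
  apply: ge0_le_integral => //.
  - move=> w _; have [Gw|nGw] := pselect (G w).
      by apply: le_trans (grid_holder_ge0 alpha w) _; exact: grid_holder_le.
    by rewrite sup_holder_off.
  - by apply: emeasurable_funM.
rewrite ge0_integralZl_EFin ?(ltW B_gt0)//.
apply: lte_mul_pinfty; rewrite ?lee_fin ?(ltW B_gt0)//.
by apply: (integral_field_energy v_gt0 incr_meas C_ge0 d_gt0 _ incr_bound hW).
Qed.

End Modification.

Theorem corollary1p2 (R : realType) (disp : measure_display)
    (Omega : measurableType disp) (P : probability Omega R)
    (H : completeNormedModType R) (d : nat) (hd : (1 <= d)%N)
    (X : R -> 'rV[R]_d -> Omega -> H) (hX : stochastic_field X)
    (gamma beta : R) (hgamma : 0 < gamma)
    (hbeta_ge1 : 1 <= gamma -> gamma < beta)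
    (hbeta_lt1 : gamma < 1 -> gamma^-1 < beta)
    (k0 r0 : R) (hk0 : 0 < k0) (hr0 : 0 < r0)
    (r0E : r0 = expR (- (k0^-1 * expR beta^-1)))
    (g : R -> R)
    (g_nondecreasing : {in `[r0, +oo[ &, {homo g : r s / r <= s}})
    (g_continuous : {within `[r0, +oo[, continuous g})
    (g_r0 : g r0 = phi_log k0 beta r0)
    (hX_meas : forall x y : 'rV[R]_d, cube x -> cube y ->
       measurable_fun setT (sup_increment X gamma x y))
    (C : R) (hC : 0 < C)
    (hX_bound : forall x y : 'rV[R]_d, cube x -> cube y ->
       (\int[P]_w sup_increment X gamma x y w <=
        (C * enorm (x - y) ^+ d * phi k0 r0 beta g (enorm (x - y)))%:E)%E)
    (theta : R)
    (htheta_ge1 : 1 <= gamma -> beta^-1 < theta < gamma^-1)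
    (htheta_lt1 : gamma < 1 -> (beta * gamma)^-1 < theta < gamma^-1) :
  exists Xt : R -> 'rV[R]_d -> Omega -> H,
    [/\ is_realization P X Xt,
        continuous_in_x P Xt &
        forall alpha : R, 0 < alpha <= gamma^-1 - theta ->
          measurable_fun setT
            (sup_holder Xt gamma alpha (phi k0 r0 beta g)) /\
          (\int[P]_w sup_holder Xt gamma alpha (phi k0 r0 beta g) w < +oo)%E].
Proof.
have beta_gt1 : 1 < beta.
  have [g1|g1] := ltP gamma 1; last exact: le_lt_trans (hbeta_ge1 g1).
  by apply: lt_trans (hbeta_lt1 g1); rewrite invf_gt1.
have beta_gt0 : 0 < beta by lra.
have theta_lt : theta < gamma^-1.
  by have [/htheta_lt1|/htheta_ge1] := ltP gamma 1; case/andP.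
apply: (@holder_modification R disp Omega P H d hd X hX gamma hgamma hX_meas
  (phi k0 r0 beta g) _ _ _ _ C (ltW hC) hX_bound (gamma^-1 - theta)).
- by move=> r; exact: phi_gt0.
- by move=> r s; exact: phi_le.
- by move=> r e; exact: phi_right_usc.
- exact: phi_dyadic_doubling.
- by rewrite subr_gt0.
move=> alpha /andP[alpha_gt0 alpha_le].
(* From [alpha <= 1/gamma - theta], the exponent is at least [theta gamma] if [gamma < 1] and at
   least [theta] otherwise; the lower bound on [theta] makes either exceed [1 / beta]. *)
have qb : 1 < chaining_exponent gamma alpha * beta.
  rewrite /chaining_exponent; have [g1|g1] := ltP gamma 1.
    have /andP[t1 _] := htheta_lt1 g1.
    have {}t1 : 1 < theta * gamma * beta.
      by rewrite -mulrA [gamma * _]mulrC -ltr_pdivrMr ?mulr_gt0// mul1r.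
    apply: lt_le_trans t1 _; rewrite ler_pM2r// lerBrDr -mulrDl.
    by rewrite -ler_pdivlMr// mul1r addrC -lerBrDr.
  have /andP[t1 _] := htheta_ge1 g1.
  have {}t1 : 1 < theta * beta by rewrite -ltr_pdivrMr// mul1r.
  by apply: lt_le_trans t1 _; rewrite ler_pM2r// lerBrDr addrC -lerBrDr.
apply: phi_dyadic_summable => //.
by rewrite -(pmulr_lgt0 _ beta_gt0) (lt_trans ltr01 qb).
Qed.
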